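(* Let $I$ be a compact interval in the real line and let $f : I \to I$ be continuous. Each of the following statements implies that $f$ has periodic points of all even periods and that $f^2$ is doubly turbulent on $I$: (1) There exist a point $c \in I$ and an odd integer $n > 1$ such that $f^n(c) \le c < f(c)$ or $f(c) < c \le f^n(c)$ (in particular, the conclusion holds if $f$ has a periodic point of odd period $> 1$). (2) The chain recurrent points of $f$ are dense in $I$ and $f^2(a) \ne a$ for some point $a \in I$. (3) The $\omega$-limit set $\omega_f(b)$ of some point $b \in I$ contains a fixed point $z$ of $f$ and a point different from $z$. (4) There is a point in $I$ which is not asymptotically periodic of period 1 or 2, and the set $\{(x,y) \in I \times I : \liminf_{n\to\infty} |f^n(x) - f^n(y)| = 0\}$ is dense in $I \times I$ (in particular, the conclusion holds if $f$ is densely chaotic). (5) There is a point $c \in I$ such that $$\limsup_{n\to\infty} |f^n(c) - f^{n+1}(c)| > 0 \quad\text{and}\quad \liminf_{n\to\infty} |f^n(c) - f^{n+1}(c)| = 0.$$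
   Context: $f^n$ denotes the $n$-fold iterate of $f$. ''Period'' of a periodic point means least period. Intervals are nondegenerate. For a continuous map $g : I \to I$ and a compact interval $J \subset I$, $g$ is turbulent on $J$ (and on $I$) if there exist two compact subintervals $J_0, J_1$ of $J$ with at most one point in common such that $g(J_0) \cap g(J_1) \supset J_0 \cup J_1$. The map $g$ is doubly turbulent on $I$ if there exist two compact subintervals $K$ and $L$ of $I$ with at most one point in common such that $g$ is turbulent on $K$ and on $L$. A point $x \in I$ is a chain recurrent point of $f$ if for every $\varepsilon > 0$ there exist an integer $n \ge 1$ and points $x_0, x_1, \dots, x_n \in I$ such that $x_0 = x = x_n$ and $|f(x_i) - x_{i+1}| < \varepsilon$ for all $0 \le i \le n-1$. The $\omega$-limit set $\omega_f(b)$ is the set of all limit points of subsequences of $(f^n(b))_{n \ge 0}$, i.e. $\omega_f(b) = \bigcap_{m\ge 0} \overline{\{f^n(b) : n \ge m\}}$. A point $x \in I$ is asymptotically periodic of period 1 or 2 if there is a point $y \in I$ with $f^2(y) = y$ such that $\lim_{n\to\infty} |f^n(x) - f^n(y)| = 0$. The map $f$ is densely chaotic if the set $LY(f) = \{(x,y) \in I \times I : \limsup_{n\to\infty} |f^n(x) - f^n(y)| > 0 \text{ and } \liminf_{n\to\infty} |f^n(x) - f^n(y)| = 0\}$ is dense in $I \times I$. *)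

(* Defs.v *)
From mathcomp Require Import all_boot all_order all_algebra.
From mathcomp Require Import all_classical all_reals all_analysis.
Set Implicit Arguments.
Unset Strict Implicit.
Unset Printing Implicit Defensive.
Import Order.TTheory GRing.Theory Num.Theory.
Import numFieldNormedType.Exports.
Local Open Scope classical_set_scope.
Local Open Scope ring_scope.

(* A self-map of a compact interval [I] is represented by [f : R -> R] with
   [f @` I `<=` I]; the values of [f] outside [I] are never used, every point
   being required below to lie in [I]. *)

Definition compact_interval (R : realType) (J : set R) : Prop :=
  exists u v : R, u < v /\ J = [set` `[u, v]].

Definition turbulent (R : realType) (g : R -> R) (J : set R) : Prop :=
  exists J0 J1 : set R,
    [/\ compact_interval J0 /\ J0 `<=` J,
        compact_interval J1 /\ J1 `<=` J,
        is_subset1 (J0 `&` J1) &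
        J0 `|` J1 `<=` (g @` J0) `&` (g @` J1)].

Definition doubly_turbulent (R : realType) (g : R -> R) (I : set R) : Prop :=
  exists K L : set R,
    [/\ compact_interval K /\ K `<=` I,
        compact_interval L /\ L `<=` I,
        is_subset1 (K `&` L),
        turbulent g K &
        turbulent g L].

Definition periodic_point (R : realType) (I : set R) (f : R -> R) (n : nat)
    (x : R) : Prop :=
  [/\ I x, (0 < n)%N, iter n f x = x &
      forall m : nat, (0 < m < n)%N -> iter m f x <> x].

Definition chain_recurrent (R : realType) (I : set R) (f : R -> R)
    (x : R) : Prop :=
  forall eps : R, 0 < eps ->
    exists (n : nat) (s : nat -> R),
      [/\ (1 <= n)%N,
          forall i : nat, (i <= n)%N -> I (s i),
          s 0%N = x, s n = x &
          forall i : nat, (i < n)%N -> `|f (s i) - s i.+1| < eps].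

Definition omega_limit (R : realType) (f : R -> R) (b : R) : set R :=
  \bigcap_(m in [set: nat])
    closure [set iter n f b | n in [set n : nat | (m <= n)%N]].

Definition asymptotically_periodic_1_2 (R : realType) (I : set R)
    (f : R -> R) (x : R) : Prop :=
  exists y : R, [/\ I y, iter 2 f y = y &
    `|iter n f x - iter n f y| @[n --> \oo] --> (0 : R)].

(* The upper and lower limits are taken in the extended reals, where they
   always exist. *)
Definition limsup_dist (R : realType) (f : R -> R) (x y : R) : \bar R :=
  limn_esup (fun n : nat => `|iter n f x - iter n f y|%:E).

Definition liminf_dist (R : realType) (f : R -> R) (x y : R) : \bar R :=
  limn_einf (fun n : nat => `|iter n f x - iter n f y|%:E).

Definition proximal_pairs (R : realType) (I : set R) (f : R -> R) :
    set (R * R) :=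
  [set p | [/\ I p.1, I p.2 & liminf_dist f p.1 p.2 = 0%E]].

Definition LY (R : realType) (I : set R) (f : R -> R) : set (R * R) :=
  [set p | [/\ I p.1, I p.2, (0 < limsup_dist f p.1 p.2)%E &
               liminf_dist f p.1 p.2 = 0%E]].

(* [dense] of the library means dense in the whole type. *)
Definition dense_in (T : topologicalType) (A S : set T) : Prop :=
  S `<=` A /\ A `<=` closure S.

Definition densely_chaotic (R : realType) (I : set R) (f : R -> R) : Prop :=
  dense_in (I `*` I) (LY I f).

(* Main.v *)
(* Write g = f^2 and suppose that the conclusion fails for f.  The key step
   concerns a fixed point z and a point v < z < f v with g v < v.  Let a be the
   first fixed point of g above v and s the last point below v with g s = a.  If
   g takes a value <= s on [s, a], then g has a horseshoe there; as f maps
   [s, a] to the other side of z, g has another horseshoe on that side and the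
   periods under f are even, so the conclusion holds.  Hence [s, a] is, up to
   shrinking, mapped by g strictly into itself: a trap, on which orbits alternate
   around z for ever.  Traps exclude horseshoes of f; then in every orbit the
   points moving up lie below some fixed point z and those moving down above it.
   For (1), an odd return forces two consecutive points on the same side of z,
   hence p < z with z <= g p, and the orbit cannot come back below p.  For (3),
   (4) and (5), every orbit is asymptotically periodic of period 1 or 2 or enters
   a trap, where it is not proximal to its image and has no fixed limit point.
   For (2), a trap contains an open set of points that are not chain recurrent,
   which leaves only absorbing intervals around the points with f^2 c <> c. *)
Require Import Defs.
From mathcomp Require Import all_boot all_order all_algebra.
From mathcomp Require Import all_classical all_reals all_analysis.
From mathcomp Require Import ring lra zify.
Import Order.TTheory GRing.Theory Num.Theory.
Import numFieldNormedType.Exports.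
Local Open Scope classical_set_scope.
Local Open Scope ring_scope.
Set Implicit Arguments.
Unset Strict Implicit.

(** * First and last hitting points of continuous functions *)

Section ContinuousFunctions.
Variable R : realType.
Implicit Types (h : R -> R) (a b x y : R).

Lemma continuous_eps h x e : continuous h -> 0 < e ->
  exists2 d, 0 < d & forall y, `|y - x| < d -> `|h y - h x| < e.
Proof.
move=> ch e0; have /cvgrPdist_lt/(_ _ e0) := ch x.
rewrite near_simpl -nbhs_nearE => -[d d0 hd]; exists d => // y yx.
by rewrite distrC; apply: hd; rewrite /= /ball_/= distrC.
Qed.

Lemma ivt_up h a b y : continuous h -> a <= b -> h a <= y <= h b ->
  exists2 x, a <= x <= b & h x = y.
Proof.
move=> ch ab /andP[hay hyb].
have := @IVT R h a b y ab (continuous_subspaceT ch).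
rewrite (min_idPl (le_trans hay hyb)) (max_idPr (le_trans hay hyb)) hay hyb.
by move=> /(_ isT)[x xab hx]; exists x.
Qed.

Lemma ivt_down h a b y : continuous h -> a <= b -> h b <= y <= h a ->
  exists2 x, a <= x <= b & h x = y.
Proof.
move=> ch ab /andP[hby hya].
have := @IVT R h a b y ab (continuous_subspaceT ch).
rewrite (min_idPr (le_trans hby hya)) (max_idPl (le_trans hby hya)) hby hya.
by move=> /(_ isT)[x xab hx]; exists x.
Qed.

Lemma itv_max h a b : continuous h -> a <= b ->
  exists2 c, a <= c <= b & forall t, a <= t <= b -> h t <= h c.
Proof.
move=> ch ab; have [c cab hc] := EVT_max ab (continuous_subspaceT ch).
by exists c => // t tab; apply: hc; rewrite in_itv.
Qed.

Lemma itv_min h a b : continuous h -> a <= b ->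
  exists2 c, a <= c <= b & forall t, a <= t <= b -> h c <= h t.
Proof.
move=> ch ab; have [c cab hc] := EVT_min ab (continuous_subspaceT ch).
by exists c => // t tab; apply: hc; rewrite in_itv.
Qed.

Lemma between_max a x y : x < a -> y < a -> exists t, [/\ x < t, y < t & t < a].
Proof.
move=> xa ya; exists ((Num.max x y + a) / 2).
by case: (leP x y) => ?; split; lra.
Qed.

Lemma between_min a x y : a < x -> a < y -> exists t, [/\ a < t, t < x & t < y].
Proof.
move=> ax ay; exists ((a + Num.min x y) / 2).
by case: (leP x y) => ?; split; lra.
Qed.

Lemma continuous_mirror h : continuous h -> continuous (fun x => - h (- x)).
Proof.
move=> ch x; apply: continuousN.
by apply: (@continuous_comp _ _ _ -%R h); [exact: opp_continuous | exact: ch].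
Qed.

Lemma continuous_opp h : continuous h -> continuous (fun x => - h x).
Proof. by move=> ch x; apply: continuousN; exact: ch. Qed.

Lemma continuous_subid h : continuous h -> continuous (fun x => h x - x).
Proof. by move=> ch x; apply: continuousB; [exact: ch | exact: cvg_id]. Qed.

(** The point is the infimum of the [t] in [[a, b]] with [y <= h t]; continuity gives [y <= h]
    there, and an excess would yield an earlier hit by the intermediate value theorem. The other
    hitting lemmas follow by negation and reflection. *)
Lemma first_up h a b y : continuous h -> a <= b -> h a < y -> y <= h b ->
  exists x, [/\ a < x <= b, h x = y & forall t, a <= t < x -> h t < y].
Proof.
move=> ch ab hay yhb.
pose S := [set t | a <= t <= b /\ y <= h t].
have Sb : S b by rewrite /S/= ab lexx.
have lS : has_lbound S by exists a => t [/andP[]].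
have hS : has_inf S by split => //; exists b.
have Sge t : S t -> inf S <= t by move=> St; exact: ge_inf.
have hle : y <= h (inf S).
  rewrite leNgt; apply/negP => hlt.
  have e0 : 0 < y - h (inf S) by rewrite subr_gt0.
  have [d d0 hd] := continuous_eps (inf S) ch e0.
  have [t St td] := inf_adherent d0 hS.
  have tS := Sge _ St.
  have /hd : `|t - inf S| < d by rewrite ger0_norm; lra.
  by case: St => _ yt /(le_lt_trans (ler_norm _)); lra.
have aS : a <= inf S by apply: lb_le_inf; [exists b | move=> t [/andP[]]].
have Slt t : a <= t < inf S -> h t < y.
  move=> /andP[at_ tS]; rewrite ltNge; apply/negP => yt.
  have /Sge : S t by split => //; rewrite at_/=; have := Sge _ Sb; lra.
  by rewrite leNgt tS.
have Sle := Sge _ Sb.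
exists (inf S); split => //.
  rewrite Sle andbT lt_neqAle aS andbT; apply/eqP => aE.
  by move: hle; rewrite -aE leNgt hay.
apply/eqP; rewrite eq_le hle andbT.
have [|t tab ht] := ivt_up (y := y) ch aS; first by rewrite hle ltW.
have [tS|St] := ltP t (inf S); last by rewrite (_ : inf S = t) ?ht //; lra.
by have /Slt : a <= t < inf S; [lra | rewrite ht ltxx].
Qed.

Lemma first_down h a b y : continuous h -> a <= b -> y < h a -> h b <= y ->
  exists x, [/\ a < x <= b, h x = y & forall t, a <= t < x -> y < h t].
Proof.
move=> ch ab hay yhb.
have [||x [xab hx H]] := first_up (y := - y) (continuous_opp ch) ab.
- by rewrite ltrN2.
- by rewrite lerN2.
exists x; split=> //; first exact: oppr_inj.
by move=> t /H; rewrite ltrN2.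
Qed.

Lemma last_up h a b y : continuous h -> a <= b -> h a <= y -> y < h b ->
  exists x, [/\ a <= x < b, h x = y & forall t, x < t <= b -> y < h t].
Proof.
move=> ch ab hay yhb.
have [|||x [xab hx H]] :=
  first_up (a := - b) (b := - a) (y := - y) (continuous_mirror ch).
- by rewrite lerN2.
- by rewrite opprK ltrN2.
- by rewrite opprK lerN2.
exists (- x); split; first by lra.
  exact: oppr_inj.
by move=> t tb; rewrite -ltrN2 -[t]opprK; apply: H; lra.
Qed.

Lemma last_down h a b y : continuous h -> a <= b -> y <= h a -> h b < y ->
  exists x, [/\ a <= x < b, h x = y & forall t, x < t <= b -> h t < y].
Proof.
move=> ch ab hay yhb.
have [||x [xab hx H]] := last_up (y := - y) (continuous_opp ch) ab.
- by rewrite lerN2.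
- by rewrite ltrN2.
exists x; split=> //; first exact: oppr_inj.
by move=> t /H; rewrite ltrN2.
Qed.

Lemma first_fixed h a b : continuous h -> a <= b -> a < h a -> h b <= b ->
  exists x, [/\ a < x <= b, h x = x & forall t, a <= t < x -> t < h t].
Proof.
move=> ch ab ha hb.
have [||x [xab hx H]] := first_down (y := 0) (continuous_subid ch) ab; try lra.
by exists x; split=> //; [lra | move=> t /H; lra].
Qed.

Lemma first_fixed_down h a b : continuous h -> a <= b -> h a < a -> b <= h b ->
  exists x, [/\ a < x <= b, h x = x & forall t, a <= t < x -> h t < t].
Proof.
move=> ch ab ha hb.
have [||x [xab hx H]] := first_up (y := 0) (continuous_subid ch) ab; try lra.
by exists x; split=> //; [lra | move=> t /H; lra].
Qed.

Lemma last_fixed h a b : continuous h -> a <= b -> h a <= a -> b < h b ->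
  exists x, [/\ a <= x < b, h x = x & forall t, x < t <= b -> t < h t].
Proof.
move=> ch ab ha hb.
have [||x [xab hx H]] := last_up (y := 0) (continuous_subid ch) ab; try lra.
by exists x; split=> //; [lra | move=> t /H; lra].
Qed.

(** Stop at the first hit of [q], then go back to the last hit of [p] before it. This builds nested
    intervals with a prescribed itinerary. *)
Lemma shrink_up h a b p q : continuous h -> a <= b -> p < q ->
  h a <= p -> q <= h b ->
  exists p' q', [/\ a <= p' < q', q' <= b, h p' = p, h q' = q &
    forall t, p' <= t <= q' -> p <= h t <= q].
Proof.
move=> ch ab pq hap qhb.
have [||q' [q'ab hq' Hq]] := first_up (y := q) ch ab; try lra.
have [|||p' [p'ab hp' Hp]] := last_up (a := a) (b := q') (y := p) ch; try lra.
exists p', q'; split; try lra.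
move=> t /andP[]; rewrite le_eqVlt => /predU1P[<-|pt]; first by lra.
rewrite le_eqVlt => /predU1P[->|tq]; first by lra.
have /Hq : a <= t < q' by lra.
have /Hp : p' < t <= q' by lra.
lra.
Qed.

Lemma shrink_down h a b p q : continuous h -> a <= b -> p < q ->
  q <= h a -> h b <= p ->
  exists p' q', [/\ a <= p' < q', q' <= b, h p' = q, h q' = p &
    forall t, p' <= t <= q' -> p <= h t <= q].
Proof.
move=> ch ab pq hap qhb.
have [|||p' [q' [? ? ? ? H]]] :=
  shrink_up (p := - q) (q := - p) (continuous_opp ch) ab; try lra.
exists p', q'; split; try lra.
by move=> t /H; lra.
Qed.

Lemma continuous_comp2 h : continuous h -> continuous (fun x => h (h x)).
Proof. by move=> ch x; exact: (continuous_comp (ch x) (ch (h x))). Qed.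

Lemma continuous_iter h n : continuous h -> continuous (iter n h).
Proof.
move=> ch; elim: n => [x|n IHn x]; first exact: cvg_id.
exact: (continuous_comp (IHn x) (ch _)).
Qed.

End ContinuousFunctions.

(** * Horseshoes and even periods *)

Definition turb (R : realType) (h : R -> R) (k l : R) : Prop :=
  exists a b c d, [/\ k <= a < b, b <= c, c < d <= l &
    forall y, a <= y <= b \/ c <= y <= d ->
      (exists2 x, a <= x <= b & h x = y) /\ (exists2 x, c <= x <= d & h x = y)].

Definition rich_dynamics (R : realType) (lo hi : R) (F : R -> R) : Prop :=
  (forall n, (0 < n)%N -> exists x,
    [/\ lo <= x <= hi, iter (2 * n) F x = x &
        forall m, (0 < m < 2 * n)%N -> iter m F x <> x]) /\
  exists k1 l1 k2 l2,
    [/\ lo <= k1, l1 <= k2, l2 <= hi, turb (iter 2 F) k1 l1 &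
        turb (iter 2 F) k2 l2].

(* [F] is constant on each side of [[lo, hi]], so that a neighbourhood of [lo] or
   [hi] needs no special treatment. *)
Definition interval_map (R : realType) (lo hi : R) (F : R -> R) : Prop :=
  [/\ lo < hi, continuous F, forall x, lo <= F x <= hi,
      forall x, x <= lo -> F x = F lo & forall x, hi <= x -> F x = F hi].

(** Conjugation by [x -> - x]; it turns each statement about points moving up into one about points
    moving down. *)
Definition mirror (R : realType) (F : R -> R) (x : R) : R := - F (- x).

Section Horseshoes.
Variable R : realType.
Implicit Types (h F : R -> R) (a b c x y lo hi : R).

Lemma iter_mirror F n x : iter n (mirror F) x = - iter n F (- x).
Proof.
elim: n => [|n IHn] /=; first by rewrite opprK.
by rewrite IHn /mirror opprK.
Qed.

Lemma interval_map_mirror lo hi F :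
  interval_map lo hi F -> interval_map (- hi) (- lo) (mirror F).
Proof.
move=> [lohi cF Fb Flo Fhi]; split.
- by rewrite ltrN2.
- exact: continuous_mirror.
- by move=> x; rewrite /mirror; have := Fb (- x); lra.
- by move=> x hx; rewrite /mirror opprK Fhi //; lra.
- by move=> x hx; rewrite /mirror opprK Flo //; lra.
Qed.

Lemma turb_mirror F k l :
  turb (iter 2 (mirror F)) k l -> turb (iter 2 F) (- l) (- k).
Proof.
move=> [a [b [c [d [ab bc cd H]]]]].
exists (- d), (- c), (- b), (- a); split; try lra.
move=> y hy; have [|[x xab hx] [x' xcd hx']] := H (- y).
  by case: hy => ?; [right|left]; lra.
split.
- exists (- x'); first by lra.
  by apply: oppr_inj; rewrite -iter_mirror.
- exists (- x); first by lra.
  by apply: oppr_inj; rewrite -iter_mirror.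
Qed.

Lemma rich_dynamics_mirror lo hi F :
  rich_dynamics (- hi) (- lo) (mirror F) -> rich_dynamics lo hi F.
Proof.
move=> [H [k1 [l1 [k2 [l2 [? ? ? T1 T2]]]]]]; split.
  move=> n /H[x [xb xn xm]]; exists (- x); split; first by lra.
    by apply: oppr_inj; rewrite -iter_mirror opprK.
  move=> m /xm xm' e; apply: xm'.
  by rewrite iter_mirror e opprK.
exists (- l2), (- k2), (- l1), (- k1).
by split; [lra|lra|lra|exact: turb_mirror|exact: turb_mirror].
Qed.

(** The values at [x], [y], [w] lie alternately beyond opposite ends of [[x, w]], so [[x, y]] and
    [[y, w]] both cover [[x, w]]. *)
Lemma horseshoe_turb h x y w : continuous h -> x < y < w ->
  [\/ [/\ h x <= x, w <= h y & h w <= x] | [/\ w <= h x, h y <= x & w <= h w]] ->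
  turb h x w.
Proof.
move=> ch /andP[xy yw] H; exists x, y, y, w; split; try lra.
move=> t ht; case: H => -[hx hy hw]; split.
- by apply: (ivt_up (h := h)) => //; lra.
- by apply: (ivt_down (h := h)) => //; lra.
- by apply: (ivt_down (h := h)) => //; lra.
- by apply: (ivt_up (h := h)) => //; lra.
Qed.

(** Pull [[b, c]] back repeatedly along the increasing branch over [[c, a]], then once along the
    decreasing branch over [[b, c]]; on the resulting interval [iter n h x - x] changes sign. *)
Lemma itinerary h a b c n : continuous h -> b < c < a ->
  h a = a -> h b = a -> h c = b -> (0 < n)%N ->
  exists x, [/\ b <= x <= c, iter n h x = x &
    forall i, (0 < i < n)%N -> c <= iter i h x <= a].
Proof.
move=> ch bca ha hb hc.
have P k : exists p q, [/\ b <= p < q, q <= a, iter k h p = b, iter k h q = c &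
    forall x, p <= x <= q -> forall i, (i < k)%N -> c <= iter i h x <= a].
  elim: k => [|k [p [q [pq qa hp hq H]]]]; first by exists b, c; split => //=; lra.
  have [||||p' [q' [pq' qa' hp' hq' H']]] :=
    shrink_up (h := h) (a := c) (b := a) (p := p) (q := q) ch; try lra.
  exists p', q'; split; try lra; rewrite ?iterSr ?hp' ?hq' //.
  move=> x xpq [_ /=|i]; first by lra.
  by rewrite ltnS iterSr => /H; apply; exact: H'.
case: n => // k _; have [p [q [pq qa hp hq H]]] := P k.
have [||||p' [q' [pq' qa' hp' hq' H']]] :=
  shrink_down (h := h) (a := b) (b := c) (p := p) (q := q) ch; try lra.
have [|||x xpq hx] := ivt_down (h := fun x => iter k.+1 h x - x)
    (a := p') (b := q') (y := 0).
- exact/continuous_subid/continuous_iter.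
- lra.
- by rewrite !iterSr hp' hq' hp hq; lra.
exists x; split; [lra|lra|].
move=> [//|i]; rewrite ltnS iterSr => /H; apply; exact: H'.
Qed.

Lemma iter_iter2 F i x : iter i (iter 2 F) x = iter (2 * i) F x.
Proof. by rewrite mulnC iterM. Qed.

(* The horseshoe above [z] is spanned by two or three of the points [F a], [F b],
   [F c], and a preimage [d] of [c]. *)
Lemma image_horseshoe F a b c z hi : continuous F -> b < c < a ->
  F (F a) = a -> F (F b) = a -> F (F c) = b ->
  z <= F a <= hi -> z <= F b <= hi -> z <= F c <= hi ->
  exists k l, [/\ z <= k, l <= hi & turb (iter 2 F) k l].
Proof.
move=> cF bca Fa Fb Fc zA zB zC; have cg : continuous (iter 2 F).
  exact: continuous_iter.
have gA : iter 2 F (F a) = F a by rewrite /= Fa.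
have gB : iter 2 F (F b) = F a by rewrite /= Fb.
have gC : iter 2 F (F c) = F b by rewrite /= Fc.
have AC : F c <> F a by move=> e; move: Fc; rewrite e Fa; lra.
have BC : F c <> F b by move=> e; move: Fc; rewrite e Fb; lra.
(* If [F c] exceeds both other images, the larger of these, [e], is the left end of the horseshoe,
   [F c] the right end, and [d] the turning point, with [F (F d) = F c]. *)
have above e : e = F a \/ e = F b -> F a <= e -> F b <= e -> e < F c ->
    exists k l, [/\ z <= k, l <= hi & turb (iter 2 F) k l].
  move=> eAB Ae Be eC; have Fe : F e = a by case: eAB => ->.
  have [|d dec Fd] := ivt_down (y := c) cF (ltW eC); first by rewrite Fe Fc; lra.
  have de : d <> e by move=> E; move: Fd; rewrite E Fe; lra.
  have dC : d <> F c by move=> E; move: Fd; rewrite E Fc; lra.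
  have ge : iter 2 F e = F a by rewrite /= Fe.
  exists e, (F c); split; [by lra..|].
  apply: (horseshoe_turb (y := d)) => //; first by lra.
  by left; rewrite ge gC /= Fd.
have below e : e = F a \/ e = F b -> e <= F a -> e <= F b -> F c < e ->
    exists k l, [/\ z <= k, l <= hi & turb (iter 2 F) k l].
  move=> eAB Ae Be eC; have Fe : F e = a by case: eAB => ->.
  have [|d dec Fd] := ivt_up (y := c) cF (ltW eC); first by rewrite Fe Fc; lra.
  have de : d <> e by move=> E; move: Fd; rewrite E Fe; lra.
  have dC : d <> F c by move=> E; move: Fd; rewrite E Fc; lra.
  have ge : iter 2 F e = F a by rewrite /= Fe.
  exists (F c), e; split; [by lra..|].
  apply: (horseshoe_turb (y := d)) => //; first by lra.
  by right; rewrite ge gC /= Fd.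
have [AB|BA] := leP (F a) (F b).
- have [?|?] := ltP (F c) (F a); first by apply: (below (F a)) => //; left.
  have [?|?] := ltP (F b) (F c); first by apply: (above (F b)) => //; right.
  exists (F a), (F b); split; [by lra..|].
  by apply: (horseshoe_turb (y := F c)) => //; [lra|left; rewrite gA gB gC].
- have [?|?] := ltP (F c) (F b); first by apply: (below (F b)) => //; [right|exact: ltW].
  have [?|?] := ltP (F a) (F c); first by apply: (above (F a)) => //; [left|exact: ltW].
  exists (F b), (F a); split; [by lra..|].
  by apply: (horseshoe_turb (y := F c)) => //; [lra|right; rewrite gA gB gC].
Qed.

(** [F^2] has a horseshoe on [[b, a]], [F] carries it to a second one beyond [z], and the two sides
    of [z] separate even from odd iterates, so periods under [F^2] double under [F]. *)
Lemma flip_horseshoe lo hi F a b c z : interval_map lo hi F ->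
  lo <= b -> b < c < a -> a <= z -> a <= hi -> (forall x, b <= x <= a -> z <= F x) ->
  F (F a) = a -> F (F b) = a -> F (F c) = b -> rich_dynamics lo hi F.
Proof.
move=> [lohi cF Fb _ _] lob bca az ahi zF Fa Fb' Fc.
have cg : continuous (iter 2 F) by exact: continuous_iter.
split.
  move=> n n0; have [x [xbc xn xi]] := itinerary cg bca Fa Fb' Fc n0.
  exists x; split; first by lra.
    by rewrite -iter_iter2.
  move=> m /andP[m0 mn] xm.
  have [i [mE|mE]] : exists i, m = (2 * i)%N \/ m = (2 * i).+1.
    by exists m./2; have := odd_double_half m; clear; case: odd; lia.
  (* A return at an earlier even time forces [x = c], but then the next visit, [F (F c) = b], falls
     below [c], against the itinerary. *)
  - have := xi i; rewrite iter_iter2 -mE xm => xca.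
    have i0 : (0 < i < n)%N by clear -m0 mn mE; lia.
    have xc : x = c by have := xca i0; lra.
    have := xi 1%N; rewrite /= xc Fc => H.
    have : c <= b <= a by apply: H; clear -i0; lia.
    lra.
  (* Odd iterates are at least [z], whereas [x <= c < a <= z]. *)
  - have xa : b <= iter (2 * i) F x <= a.
      have [->|i0] := posnP i; first by rewrite /=; lra.
      have := xi i; rewrite iter_iter2 => H.
      by have : c <= iter (2 * i) F x <= a by [apply: H; lia]; lra.
    by have := zF _ xa; have := xm; rewrite mE iterS => ->; lra.
have T1 : turb (iter 2 F) b a.
  by apply: (horseshoe_turb (y := c)) => //; right; rewrite /= Fa Fb' Fc; split.
have [k [l [zk lh T2]]] : exists k l, [/\ z <= k, l <= hi & turb (iter 2 F) k l].
  have zFhi x : b <= x <= a -> z <= F x <= hi.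
    by move=> /zF ->; have /andP[] := Fb x.
  apply: (image_horseshoe cF bca Fa Fb' Fc); apply: zFhi; lra.
by exists b, a, k, l; split => //; lra.
Qed.

End Horseshoes.

(** * Traps *)

Definition tame (R : realType) (lo hi : R) (F : R -> R) : Prop :=
  interval_map lo hi F /\ ~ rich_dynamics lo hi F.

(** The strict inequalities leave a margin, so that orbits and chains starting close enough to a
    trapped orbit are caught as well. *)
Definition trap (R : realType) (F : R -> R) (z s t : R) : Prop :=
  s < t < z /\ forall x, s <= x <= t -> z < F x /\ s < F (F x) < t.

Section Tame.
Variable R : realType.
Implicit Types (F : R -> R) (lo hi z v p x y w s t : R).

Lemma tame_mirror lo hi F : tame lo hi F -> tame (- hi) (- lo) (mirror F).
Proof.
move=> [iF nF]; split; first exact: interval_map_mirror.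
by move=> c; apply/nF/rich_dynamics_mirror.
Qed.

Lemma expanding_flip_trap lo hi F z v : tame lo hi F -> F z = z -> v < z < F v ->
  F (F v) < v -> exists s t, s < v < t /\ trap F z s t.
Proof.
move=> [iF nC] Fz vzF gv; have [lohi cF Fb Flo Fhi] := iF.
have cg := continuous_comp2 cF.
have zhi : z <= hi by have := Fb z; rewrite Fz; lra.
have lov : lo <= v by have := Fb (F v); lra.
have [|||a [vaz ga gid]] := first_fixed_down (a := v) (b := z) cg.
- lra.
- exact: gv.
- by rewrite !Fz.
(* Between [v] and a point not mapped beyond [z] lies a preimage [w] of [z]. Then [F (F w) = z],
   which the upper bounds on [F^2] will forbid. *)
have Fside x y : F v > z -> F x <= z ->
    exists2 w, F w = z & x <= w < v \/ v < w <= x.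
  move=> zv xz; have [xv|vx] := leP x v.
    have [|w wx Fw] := ivt_up (y := z) cF xv; first by lra.
    exists w => //; left; suff : w <> v by lra.
    by move=> wv; move: zv; rewrite -wv Fw ltxx.
  have [|w wx Fw] := ivt_down (y := z) cF (ltW vx); first by lra.
  exists w => //; right; suff : w <> v by lra.
  by move=> wv; move: zv; rewrite -wv Fw ltxx.
have Fvz : F v > z by lra.
have gz w : F w = z -> F (F w) = z by move=> ->.
(* Given such an [s], choose [t] in [(v, a)] above the maximum of [F^2] on [[s, v]]; on [[v, a)] all
   points are moved down by [F^2]. *)
suff [s [sv Hs Hv]] : exists s, [/\ s < v, forall x, s <= x <= a -> s < F (F x) &
    forall x, s <= x <= v -> F (F x) < a].
  have [c cv Hc] := itv_max cg (ltW sv).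
  have ca := Hv _ cv.
  have va : v < a by case/andP: vaz.
  have [t [m1 m2 m3]] := between_max ca va.
  exists s, t; split; first by rewrite sv.
  split; first by lra.
  move=> x xst.
  have gx : s < F (F x) < t.
    have [xv|vx] := leP x v.
      have h1 : s < F (F x) by apply: Hs; lra.
      have h2 : F (F x) <= F (F c) by apply: Hc; lra.
      lra.
    have h1 : s < F (F x) by apply: Hs; lra.
    have h2 : F (F x) < x by apply: gid; lra.
    lra.
  split=> //; rewrite ltNge; apply/negP => /(Fside x x Fvz)[w Fw wx].
  have [wv|vw] := leP w v.
    by have : F (F w) < a by [apply: Hv; lra]; rewrite gz //; lra.
  by have : F (F w) < w by [apply: gid; lra]; rewrite gz //; lra.
have [s0P|s0N] := pselect (exists2 x, lo <= x <= v & a <= F (F x)); last first.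
  have Hlt x : x <= v -> F (F x) < a.
    move=> xv; rewrite ltNge; apply/negP => ax; apply: s0N.
    have [xlo|lox] := leP x lo; last by exists x => //; lra.
    by exists lo; [lra|rewrite -(Flo _ xlo)].
  (* [lo - 1] lies strictly below all values of [F], and the constant extension left of [lo] keeps
     [F^2] below [a] there. *)
  exists (lo - 1); split; [lra| |].
    by move=> x _; have := Fb (F x); lra.
  by move=> x xv; apply: Hlt; lra.
have [x0 x0v gx0] := s0P.
have [|||s0 [s0v gs0 Hs0]] := last_down (a := x0) (b := v) (y := a) cg; try lra.
have Hin w : s0 < w < a -> F (F w) < a.
  move=> wa; have [wv|vw] := leP w v; first by apply: Hs0; lra.
  have : F (F w) < w by apply: gid; lra.
  lra.
have zF x : s0 <= x <= a -> z <= F x.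
  move=> xa; rewrite leNgt; apply/negP => Fx.
  have [w Fw wx] := Fside x x Fvz (ltW Fx).
  have wx' : w <> x by move=> e; move: Fx; rewrite -e Fw ltxx.
  by have : F (F w) < a by [apply: Hin; lra]; rewrite gz //; lra.
(* Otherwise [F^2] takes the value [s0] at some [c'] in [(s0, a)], and [s0], [c'], [a] satisfy the
   hypotheses of [flip_horseshoe]. *)
have Hs c : s0 <= c <= a -> s0 < F (F c).
  move=> ca; rewrite ltNge; apply/negP => gc.
  have [|||c' [c'a gc' _]] := last_up (a := c) (b := a) (y := s0) cg; try lra.
  have cs0 : c' <> s0 by move=> e; move: gc'; rewrite e gs0; lra.
  apply: nC; apply: (@flip_horseshoe _ lo hi F a s0 c' z) => //; lra.
have [|c ca Hc] := itv_min (a := s0) (b := a) cg; first by lra.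
have s0m := Hs _ ca.
have sv : s0 < v by case/andP: s0v.
(* [F^2] equals [a] at [s0]; moving up slightly, but below the minimum of [F^2] on [[s0, a]], makes
   both inequalities strict. *)
have [s [m3 m1 m2]] := between_min s0m sv.
exists s; split => //.
  by move=> x xa; apply: (lt_le_trans m1); apply: Hc; lra.
by move=> x xv; apply: Hs0; lra.
Qed.

(** If [F (F v) <= p], the trap around [v] contains [F (F v)], hence also [p], and then
    [F (F p) < z]. *)
Lemma no_flip_horseshoe lo hi F z p v : tame lo hi F -> F z = z -> p < v ->
  v < z < F v -> z <= F (F p) -> p < F (F v).
Proof.
move=> tF Fz pv vzF gp; rewrite ltNge; apply/negP => gv.
have [|s [t [svt [stz H]]]] := expanding_flip_trap tF Fz vzF; first by lra.
have [_ gv'] : z < F v /\ s < F (F v) < t by apply: H; lra.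
by have [_ gp'] : z < F p /\ s < F (F p) < t by [apply: H; lra]; lra.
Qed.

(** A horseshoe of [F] contains a fixed point [z] above [y], a [v] with [F v = w], and a [p] in
    [[x, v]] with [F p = z]; then [F (F v) = F w <= x <= p] contradicts [no_flip_horseshoe]. *)
Lemma no_horseshoe_up lo hi F x y w : tame lo hi F -> x < y < w ->
  F x <= x -> F w <= x -> F y < w.
Proof.
move=> tF xyw Fx Fw; have [[_ cF _ _ _] _] := tF.
rewrite ltNge; apply/negP => Fy.
have [|||z [zyw Fz _]] := first_fixed (a := y) (b := w) cF; try lra.
have [|||v [vxy Fv _]] := first_up (a := x) (b := y) (y := w) cF; try lra.
have [||p pxv Fp] := ivt_up (a := x) (b := v) (y := z) cF; try lra.
have zw : z <> w by move=> e; move: Fw; rewrite -e Fz; lra.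
have pv : p <> v by move=> e; move: Fv; rewrite -e Fp; lra.
have : p < F (F v) by apply: (no_flip_horseshoe tF Fz); rewrite ?Fp ?Fz; lra.
rewrite Fv; lra.
Qed.

End Tame.

(** * Order of the points of an orbit *)

Definition sides (R : realType) (F : R -> R) (z x : R) : Prop :=
  forall i, let y := iter i F x in (y < z -> y < F y) /\ (z <= y -> F y <= y).

Section Order.
Variable R : realType.
Implicit Types (F : R -> R) (lo hi z v p x y w s t : R).

Lemma iter_invariant F (P : R -> Prop) x : P x -> (forall y, P y -> P (F y)) ->
  forall k, P (iter k F x).
Proof. by move=> Px PF; elim=> // k IHk; exact: PF. Qed.

(** Otherwise take the last fixed point [w] below [x]. To fall to [w] the orbit needs a point above
    [x] with value at most [w]; if [d] is the first one with value [w], the absence of horseshoes on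
    [[w, d]] makes [(w, d)] invariant. *)
Lemma up_before_down lo hi F x k : tame lo hi F -> x < F x ->
  F (iter k F x) <= iter k F x -> x < iter k F x.
Proof.
move=> tF xFx Fk; have [[_ cF _ _ _] _] := tF.
rewrite ltNge; apply/negP => kx.
have [|||w [wx Fw Hw]] := last_fixed (a := iter k F x) (b := x) cF; try lra.
have [[d1 xd1 Fd1]|nd] := pselect (exists2 d, x < d & F d <= w); last first.
  have : w < iter k F x; last lra.
  apply: (iter_invariant (P := fun y => w < y)) => [|y wy]; first by lra.
  have [yx|xy] := leP y x; first by have : y < F y by [apply: Hw; lra]; lra.
  by rewrite ltNge; apply/negP => Fy; apply: nd; exists y.
have xw : w < F x by lra.
have [|||d [dx Fd Hd]] := first_down (a := x) (b := d1) (y := w) cF; try lra.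
have : w < iter k F x < d; last lra.
apply: (iter_invariant (P := fun y => w < y < d)) => [|y wyd]; first by lra.
apply/andP; split; last by apply: (no_horseshoe_up tF (x := w) (y := y)); lra.
have [yx|xy] := leP y x; first by have : y < F y by [apply: Hw; lra]; lra.
by apply: Hd; lra.
Qed.

Lemma down_before_up lo hi F x k : tame lo hi F -> F x < x ->
  iter k F x <= F (iter k F x) -> iter k F x < x.
Proof.
move=> /tame_mirror tF xFx Fk.
have := @up_before_down _ _ _ (- x) k tF.
by rewrite iter_mirror /mirror !opprK lerN2 !ltrN2; apply.
Qed.

Lemma ups_below_downs lo hi F x i j : tame lo hi F ->
  iter i F x < F (iter i F x) -> F (iter j F x) <= iter j F x ->
  iter i F x < iter j F x.
Proof.
move=> tF Ui Dj; have [ij|/ltnW ji] := leqP i j.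
  move: Dj; rewrite -(subnK ij) iterD => Dj.
  exact: (up_before_down tF).
move: Ui; rewrite -(subnK ji) iterD => Ui.
move: Dj; rewrite le_eqVlt => /predU1P[Fj|Dj].
  by move: Ui; rewrite -iterS iterSr Fj ltxx.
by apply: (down_before_up tF) => //; exact: ltW.
Qed.

(** By continuity the supremum of the points moving up is not moved down. The first fixed point from
    there on separates, since all points in between are moved up. *)
Lemma separating_fixed_point lo hi F x i0 j0 : tame lo hi F ->
  iter i0 F x < F (iter i0 F x) -> F (iter j0 F x) <= iter j0 F x ->
  exists2 z, F z = z & sides F z x.
Proof.
move=> tF Ui0 Dj0; have [[_ cF _ _ _] _] := tF.
pose U := [set iter i F x | i in [set i | iter i F x < F (iter i F x)]].
have Ulub j : F (iter j F x) <= iter j F x -> ubound U (iter j F x).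
  by move=> Dj y [i Ui <-]; apply/ltW/(ups_below_downs tF).
have hU : has_sup U.
  by split; [exists (iter i0 F x), i0|exists (iter j0 F x); exact: Ulub].
have le_sup i : iter i F x < F (iter i F x) -> iter i F x <= sup U.
  by move=> Ui; apply: (sup_upper_bound hU); exists i.
have sup_le j : F (iter j F x) <= iter j F x -> sup U <= iter j F x.
  by move=> Dj; apply: ge_sup; [exists (iter i0 F x), i0|exact: Ulub].
have supU : sup U <= F (sup U).
  rewrite leNgt; apply/negP => lt.
  have e0 : 0 < (sup U - F (sup U)) / 2 by lra.
  have [d d0 Hd] := continuous_eps (sup U) cF e0.
  have m0 : 0 < Num.min d ((sup U - F (sup U)) / 2) by rewrite lt_min d0.
  have [_ [i Ui <-]] := sup_adherent m0 hU.
  rewrite ltrBlDr -ltrBlDl lt_min => /andP[h1 h2].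
  have h3 := le_sup _ Ui.
  have /Hd : `|iter i F x - sup U| < d by rewrite ler0_norm; lra.
  by move=> /(le_lt_trans (ler_norm _)); move: Ui => /=; lra.
have supj0 := sup_le _ Dj0.
have [z [Fz zU zmin]] : exists z, [/\ F z = z, sup U <= z &
    forall t, sup U <= t < z -> t < F t].
  move: supU; rewrite le_eqVlt => /predU1P[e|supU].
    by exists (sup U); split => [//|//|t tU]; lra.
  by have [z [zI Fz H]] := first_fixed cF supj0 supU Dj0; exists z; split=> //; lra.
exists z => // i; cbv zeta; split=> [yz|zy].
  rewrite ltNge; apply/negP => Dy; have := sup_le _ Dy => h.
  by have : iter i F x < F (iter i F x) by [apply: zmin; lra]; lra.
rewrite leNgt; apply/negP => Uy; have h := le_sup _ Uy.
have e : iter i F x = z by lra.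
by move: Uy; rewrite e Fz ltxx.
Qed.

Lemma sides_shift F z x k : sides F z x -> sides F z (iter k F x).
Proof. by move=> sx i; rewrite -iterD; exact: sx. Qed.

(* As long as the orbit of [x] stays above [p], its points above [z] are images
   of points of [[p, z]]. *)
Lemma orbit_stays_above F (P : R -> Prop) p z x : continuous F -> F z = z ->
  sides F z x -> (forall y, p < y -> P y) -> (forall y, P y -> p <= y) ->
  (forall v i, p <= v < z -> z < F v -> F v = iter i F x -> P (F (F v))) ->
  p <= x < z -> forall i, P (iter i.+1 F x).
Proof.
move=> cF Fz sx Pp pP H pxz.
pose Q y := p <= y /\ (z <= y -> exists2 v, p <= v <= z & F v = y).
suff QP i : Q (iter i F x) -> P (iter i.+1 F x) /\ Q (iter i.+1 F x).
  have Qi i : Q (iter i F x).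
    by elim: i => [|i /QP[]//]; split => /=; lra.
  by move=> i; have [] := QP i (Qi i).
move=> [py vy]; have [y1 y2] := sx i; rewrite iterS.
move: py vy y1 y2; set y := iter i F x => py vy y1 y2.
have [yz|zy] := ltP y z.
  have yF := y1 yz; split; first by apply: Pp; lra.
  by split; [lra|move=> zF; exists y => //; lra].
have [v vpz Fv] := vy zy; have Fy := y2 zy.
have PF : P (F y).
  have [Fvz|Fvz] := leP (F v) z.
    by have -> : y = z by [lra]; rewrite Fz; apply: Pp; lra.
  have vz : v <> z by move=> e; move: Fvz; rewrite e Fz ltxx.
  by rewrite -Fv; apply: (H v i) => //; lra.
split=> //; split; first exact: pP.
move=> zF; have [||w wvz Fw] := ivt_down (a := v) (b := z) (y := F y) cF.
- lra.
- by rewrite Fz Fv zF.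
by exists w => //; lra.
Qed.

(** A fall to [p] would come from some [v] in [[p, z)] with [F v] beyond [z] and [F (F v) <= p];
    [no_flip_horseshoe] excludes [v > p], and [z <= F (F p)] excludes [v = p]. *)
Lemma orbit_stays_strictly_above lo hi F p z x i : tame lo hi F -> F z = z ->
  sides F z x -> p < z -> z <= F (F p) -> p <= x < z -> p < iter i.+1 F x.
Proof.
move=> tF Fz sx pz gp pxz; have [[_ cF _ _ _] _] := tF.
apply: (@orbit_stays_above F (fun y => p < y) p z x) => //.
  by move=> y; exact: ltW.
move=> v j pvz zF _.
have [vp|vp] := eqVneq v p; first by rewrite vp; lra.
by apply: (no_flip_horseshoe tF Fz); rewrite ?lt_neqAle 1?eq_sym ?vp; lra.
Qed.

(** The orbit increases while it stays left of [z]; the first point [y] of it with [z <= F (F y)] is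
    a barrier for what follows. *)
Lemma left_left_bound lo hi F z m x : tame lo hi F -> F z = z -> sides F z x ->
  x < z -> F x < z -> x < iter m.+1 F x.
Proof.
move=> tF Fz; elim: m x => [|m IHm] x sx xz Fxz.
  by have [/(_ xz)] := sx 0%N.
have [ggz|ggz] := ltP (F (F x)) z; last first.
  by apply: (orbit_stays_strictly_above _ tF Fz sx) => //; lra.
have := IHm (F x) (sides_shift 1 sx) Fxz ggz.
have [/(_ xz)] := sx 0%N; rewrite -iterSr /=; lra.
Qed.

(* An odd number of steps from the left of [z] to the left of [z] stays twice in
   a row on the same side of [z]; the first time this happens gives a point [p]
   with [z <= F (F p)], below which the orbit cannot return. *)
Lemma odd_return_up lo hi F c n : tame lo hi F -> odd n -> c < F c ->
  iter n F c <= c -> False.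
Proof.
move=> tF on cF nc; have [[_ cont _ _ _] _] := tF.
have [j Dj] : exists j, F (iter j F c) <= iter j F c.
  apply: contrapT => nD.
  have Up k : c < iter k.+1 F c.
    elim: k => [//|k IHk]; apply: (lt_trans IHk); rewrite ltNge; apply/negP => D.
    by apply: nD; exists k.+1.
  by case: n on nc => // n _; rewrite leNgt Up.
have [z Fz sc] := @separating_fixed_point _ _ _ c 0 j tF cF Dj.
have cz : c < z by rewrite ltNge; apply/negP => /(sc 0%N).2 /=; lra.
have nz : iter n F c < z by lra.
pose L i := iter i F c < z.
(* If the sides alternated throughout, oddness of [n] would put [iter n F c] on the right of [z]. *)
have rep : exists i, (i < n)%N && (L i == L i.+1).
  apply: contrapT => nrep.
  have alt i : (i <= n)%N -> L i = ~~ odd i.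
    elim: i => [_|i IHi ltin]; first by rewrite /L /= cz.
    have := IHi (ltnW ltin); case E : (L i == L i.+1).
      by exfalso; apply: nrep; exists i; rewrite ltin E.
    by move: E => /=; case: (L i); case: (L i.+1); case: (odd i).
  by have := alt n (leqnn n); rewrite /L nz on.
case: (ex_minnP rep) => i /andP[ltin /eqP Lii] imin.
have alt k : (k < i)%N -> L k <> L k.+1.
  move=> ki e; have := imin k; rewrite e eqxx andbT (ltn_trans ki ltin).
  by move=> /(_ isT); rewrite leqNgt ki.
have [Li|] := boolP (L i).
  have Li1 : F (iter i F c) < z by move: Li; rewrite Lii.
  have [ci|ic] := leP c (iter i F c).
    have := @left_left_bound _ _ _ _ (n - i.+1) _ tF Fz (sides_shift i sc) Li Li1.
    by rewrite -iterD addSnnS subnK //; lra.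
  have i0 : (0 < i)%N by case: i ic {ltin Lii imin alt Li Li1} => //=; rewrite ltxx.
  have Fcz : z <= F c.
    by rewrite leNgt; apply/negP => Fcz; apply: (alt 0%N i0); rewrite /L /= cz Fcz.
  (* A preimage [p] of [z] in [[iter i F c, c]] is a barrier for the orbit of [c], which
     nevertheless reaches [iter i F c <= p]. *)
  have [||p pic Fp] := ivt_up (a := iter i F c) (b := c) (y := z) cont.
  - exact: ltW.
  - by rewrite (ltW Li1).
  have := @orbit_stays_strictly_above _ _ _ p z c i.-1 tF Fz sc.
  rewrite Fp Fz prednK // => H.
  by have : p < iter i F c by [apply: H; lra]; lra.
move=> Ri; have i0 : (0 < i)%N by case: i Ri {ltin Lii imin alt} => //; rewrite /L /= cz.
case: i i0 ltin Lii alt Ri {imin} => // i _ ltin Lii alt Ri.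
have Li : iter i F c < z.
  by have := alt i (leqnn _); move: Ri; rewrite /L; do 2 case: (_ < z).
(* For a repetition on the right, the last point before it, on the left of [z], is the barrier. *)
have gp : z <= F (F (iter i F c)) by move: Ri; rewrite Lii /L -leNgt.
have [cp|pc] := leP c (iter i F c).
  have := @orbit_stays_strictly_above _ _ _ _ z (iter i F c) (n - i.+1) tF Fz
    (sides_shift i sc) Li gp.
  rewrite -iterD addSnnS subnK 1?ltnW // lexx Li => /(_ isT).
  lra.
case: i {ltin Lii alt Ri} => [|i] in Li gp pc *; first by move: pc; rewrite ltxx.
have := @orbit_stays_strictly_above _ _ _ _ z c i tF Fz sc Li gp.
by rewrite ltxx => H; have : false by [apply: H; rewrite ltW].
Qed.

Lemma odd_return_down lo hi F c n : tame lo hi F -> odd n -> F c < c ->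
  c <= iter n F c -> False.
Proof.
move=> /tame_mirror tF on cF nc.
apply: (@odd_return_up _ _ _ (- c) n tF on).
  by rewrite /mirror opprK ltrN2.
by rewrite iter_mirror opprK lerN2.
Qed.

End Order.

(** * Convergence or alternation *)

Definition tends (R : realType) (u : nat -> R) (l : R) : Prop :=
  forall e, 0 < e -> exists N, forall n, (N <= n)%N -> `|u n - l| < e.

Definition frequently (P : nat -> Prop) : Prop :=
  forall N, exists2 n, (N <= n)%N & P n.

Lemma frequentlyPn (P : nat -> Prop) :
  ~ frequently P -> exists N, forall n, (N <= n)%N -> ~ P n.
Proof.
move=> nP; apply: contrapT => H; apply: nP => N; apply: contrapT => nN.
by apply: H; exists N => n Nn Pn; apply: nN; exists n.
Qed.

Section Limits.
Variable R : realType.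
Implicit Types (F : R -> R) (lo hi z v p x y w s t e l : R) (u : nat -> R).

Lemma tends_nondecreasing u N b : (forall n, (N <= n)%N -> u n <= u n.+1) ->
  (forall n, (N <= n)%N -> u n <= b) -> exists l, tends u l.
Proof.
move=> un ub; pose S := [set u n | n in [set n | (N <= n)%N]].
have hS : has_sup S.
  by split; [exists (u N), N => /= | exists b => _ [n Nn <-]; exact: ub].
have mon n k : (N <= n)%N -> u n <= u (k + n)%N.
  move=> Nn; elim: k => // k IHk; apply: (le_trans IHk); apply: un.
  by rewrite (leq_trans Nn) // leq_addl.
exists (sup S) => e e0.
have [_ [n Nn <-] ne] := sup_adherent e0 hS.
exists n => k nk; rewrite -(subnK nk).
have h1 := mon n (k - n)%N Nn.
have h2 : u (k - n + n)%N <= sup S.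
  by apply: (sup_upper_bound hS); exists (k - n + n)%N => //=; rewrite subnK // (leq_trans Nn).
by rewrite ler0_norm; lra.
Qed.

Lemma tends_nonincreasing u N b : (forall n, (N <= n)%N -> u n.+1 <= u n) ->
  (forall n, (N <= n)%N -> b <= u n) -> exists l, tends u l.
Proof.
move=> un ub; have [||l ul] := @tends_nondecreasing (fun n => - u n) N (- b).
- by move=> n /un; rewrite lerN2.
- by move=> n /ub; rewrite lerN2.
exists (- l) => e /ul[M HM]; exists M => n /HM.
by rewrite opprK -normrN opprB opprK addrC.
Qed.

Lemma limit_step F l l' : continuous F -> (forall e, 0 < e ->
  exists2 y, `|y - l| < e & `|F y - l'| < e) -> F l = l'.
Proof.
move=> cF H; apply/eqP/negP => /negP ll'.
have e0 : 0 < `|F l - l'| / 2 by rewrite divr_gt0 // normr_gt0 subr_eq0.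
have [d d0 Hd] := continuous_eps l cF e0.
have [|y] := H (Num.min d (`|F l - l'| / 2)); first by rewrite lt_min d0.
rewrite !lt_min => /andP[/Hd h1 _] /andP[_ h2].
have := ler_distD (F y) (F l) l'; rewrite (distrC (F l) (F y)); lra.
Qed.

Lemma tends_continuous F u l : continuous F -> tends u l ->
  tends (fun n => F (u n)) (F l).
Proof.
move=> cF ul e e0; have [d d0 Hd] := continuous_eps l cF e0.
by have [N HN] := ul d d0; exists N => n /HN /Hd.
Qed.

Lemma tends_unshift u l k : tends (fun n => u (k + n)%N) l -> tends u l.
Proof.
move=> ul e /ul[N HN]; exists (k + N)%N => n Nn.
by rewrite -(@subnKC k n) ?HN //; lia.
Qed.

Lemma tends_step_fixed F u l : continuous F -> tends u l ->
  (forall n, u n.+1 = F (u n)) -> F l = l.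
Proof.
move=> cF ul uF; apply: limit_step => // e e0; have [N HN] := ul e e0.
by exists (u N); [exact: HN | rewrite -uF; exact/HN/leqW].
Qed.

Lemma trap_iter F z s t y m : trap F z s t -> s <= y <= t ->
  s <= iter (2 * m) F y <= t /\ z < iter (2 * m).+1 F y.
Proof.
move=> [stz H] yst.
suff h : s <= iter (2 * m) F y <= t by split=> //; have [] := H _ h.
elim: m => [|m IHm]; first by [].
by rewrite mulnS /=; have [_] := H _ IHm; lra.
Qed.

End Limits.

Section Alternation.
Variable R : realType.
Implicit Types (F : R -> R) (lo hi z v p x y w s t e l : R).

Definition alternates F z x :=
  exists K, forall m, iter (K + 2 * m) F x < z < iter (K + 2 * m).+1 F x.

(** Only [F v] is asked to lie on the orbit, because [orbit_stays_above] provides mere preimages [v]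
    of orbit points; [F (F v)] is back in the trap. *)
Lemma trap_alternates F z s t v x k : trap F z s t -> s <= v <= t ->
  F v = iter k F x -> alternates F z x.
Proof.
move=> T vst vk; exists k.+1 => m; have [stz _] := T.
have E : iter (k.+1 + 2 * m) F x = iter (2 * m.+1) F v.
  by rewrite mulnS addSnnS addnC iterD -vk -iterSr.
have [h1 h2] := trap_iter m.+1 T vst.
by rewrite iterS E -iterS h2 andbT; lra.
Qed.

(** A fall below [iter i F x] would come from a [v] with [F (F v) < v < z < F v]; the trap around
    [v] then makes the orbit alternate. *)
Lemma left_monotone lo hi F z x i j : tame lo hi F -> F z = z -> sides F z x ->
  ~ alternates F z x -> (i <= j)%N -> iter i F x < z -> iter i F x <= iter j F x.
Proof.
move=> tF Fz sx nalt ij iz; have [[_ cF _ _ _] _] := tF.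
move: ij; rewrite leq_eqVlt => /predU1P[<-//|ij].
rewrite -(subnK ij) addnS -addSn iterD.
apply: (@orbit_stays_above _ F (fun y => iter i F x <= y) (iter i F x) z) => //.
- exact: sides_shift.
- by move=> y /ltW.
- move=> v k piv vF Fvk; have vz : v < z < F v by lra.
  suff : v <= F (F v) by lra.
  rewrite leNgt; apply/negP => gv.
  have [s [t [svt T]]] := expanding_flip_trap tF Fz vz gv.
  apply/nalt/(trap_alternates T (v := v) (k := k + i)); first by lra.
  by rewrite iterD.
- by rewrite lexx.
Qed.

Lemma alternates_mirror F z x : alternates (mirror F) (- z) (- x) ->
  alternates F z x.
Proof.
move=> [K HK]; exists K.+1 => m; have := HK m; have := HK m.+1.
rewrite mulnS addnCA !iter_mirror !opprK !ltrN2 addSn => /andP[H1 _] /andP[_ H2].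
by rewrite -addSn H2 /=.
Qed.

(** An orbit that is not eventually monotone visits both sides of a separating [z] infinitely often.
    Unless it alternates, its left points increase to some [l], its right points decrease to some
    [r], and the crossings give [F l = r], [F r = l]. *)
Lemma alternates_or_tends lo hi F x : tame lo hi F ->
  (exists2 e, F e = e & tends (fun n => iter n F x) e) \/
  (exists2 z, F z = z & alternates F z x).
Proof.
move=> tF; have [[lohi cF Fb _ _] _] := tF.
have bd n : lo <= iter n.+1 F x <= hi by exact: Fb.
have fix_tends l : tends (fun n => iter n F x) l ->
    exists2 e, F e = e & tends (fun n => iter n F x) e.
  by move=> xl; exists l => //; exact: (tends_step_fixed cF xl).
have [Up|/frequentlyPn[N HN]] :=
  pselect (frequently (fun n => iter n F x < F (iter n F x))); last first.
  left; have [||l xl] := @tends_nonincreasing _ (fun n => iter n F x) N.+1 lo.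
  - by move=> n Nn; rewrite leNgt; apply/negP/HN; rewrite ltnW.
  - by case=> // n _; have /andP[] := bd n.
  exact: fix_tends xl.
have [Dn|/frequentlyPn[N HN]] :=
  pselect (frequently (fun n => F (iter n F x) < iter n F x)); last first.
  left; have [||l xl] := @tends_nondecreasing _ (fun n => iter n F x) N.+1 hi.
  - by move=> n Nn; rewrite leNgt; apply/negP/HN; rewrite ltnW.
  - by case=> // n _; have /andP[] := bd n.
  exact: fix_tends xl.
have nofix n : F (iter n F x) <> iter n F x.
  move=> fx; have [m nm] := Up n; have -> : iter m F x = iter n F x.
    by rewrite -(subnK nm) iterD; elim: (m - n)%N => //= k ->.
  by rewrite fx ltxx.
have [i0 _ Ui0] := Up 0%N; have [j0 _ Dj0] := Dn 0%N.
have [z Fz sx] := separating_fixed_point tF Ui0 (ltW Dj0).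
have notz n : iter n F x <> z by move=> e; apply: (nofix n); rewrite e.
have [alt|nalt] := pselect (alternates F z x); first by right; exists z.
(* [sides] treats [z] itself asymmetrically, so mirroring it uses that the orbit contains no fixed
   point. *)
have sx' : sides (mirror F) (- z) (- x).
  move=> i; rewrite iter_mirror opprK /mirror opprK /=.
  have [h1 h2] := sx i; have := @nofix i; have := @notz i => /eqP n1 /eqP n2.
  rewrite !ltrN2 !lerN2; split=> [/ltW zi|iz].
    by rewrite lt_neqAle n2 h2.
  by apply/ltW/h1; rewrite lt_neqAle n1.
have Lmon i j : (i <= j)%N -> iter i F x < z -> iter i F x <= iter j F x.
  exact: (left_monotone tF Fz sx nalt).
have Rmon i j : (i <= j)%N -> z < iter i F x -> iter j F x <= iter i F x.
  move=> ij zi; rewrite -lerN2.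
  have := @left_monotone _ _ _ (- z) (- x) i j (tame_mirror tF).
  rewrite !iter_mirror !opprK ltrN2; apply=> //.
    by rewrite /mirror opprK Fz.
  by move=> /alternates_mirror.
have side n : iter n F x < z \/ z < iter n F x.
  by case: (ltgtP (iter n F x) z) => [|| /notz//]; [left|right].
have freqL : frequently (fun n => iter n F x < z).
  move=> N; have [n Nn Un] := Up N; exists n => //.
  by case: (side n) => // /ltW /(sx n).2; rewrite leNgt Un.
have freqR : frequently (fun n => z < iter n F x).
  move=> N; have [n Nn Un] := Dn N; exists n => //.
  by case: (side n) => // /(sx n).1 /(lt_trans Un); rewrite ltxx.
have [l Hl] : exists l, forall e, 0 < e ->
    exists N, forall n, (N <= n)%N -> iter n F x < z -> `|iter n F x - l| < e.
  pose S := [set iter n F x | n in [set n | iter n F x < z]].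
  have hS : has_sup S.
    have [n _ nz] := freqL 0%N; split; first by exists (iter n F x), n.
    by exists z => _ [k kz <-]; exact: ltW.
  exists (sup S) => e e0; have [_ [n nz <-] ne] := sup_adherent e0 hS.
  exists n => k nk kz; have := Lmon _ _ nk nz.
  have : iter k F x <= sup S by apply: (sup_upper_bound hS); exists k.
  by move=> h1 h2; rewrite ler0_norm; lra.
have [r Hr] : exists r, forall e, 0 < e ->
    exists N, forall n, (N <= n)%N -> z < iter n F x -> `|iter n F x - r| < e.
  pose S := [set iter n F x | n in [set n | z < iter n F x]].
  have hS : has_inf S.
    have [n _ nz] := freqR 0%N; split; first by exists (iter n F x), n.
    by exists z => _ [k kz <-]; exact: ltW.
  exists (inf S) => e e0; have [_ [n nz <-] ne] := inf_adherent e0 hS.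
  exists n => k nk kz; have := Rmon _ _ nk nz.
  have : inf S <= iter k F x by apply: (inf_lbound hS.2); exists k.
  by move=> h1 h2; rewrite ger0_norm; lra.
have trans (P Q : pred R) a b :
    (forall e, 0 < e -> exists N, forall n, (N <= n)%N -> P (iter n F x) ->
      `|iter n F x - a| < e) ->
    (forall e, 0 < e -> exists N, forall n, (N <= n)%N -> Q (iter n F x) ->
      `|iter n F x - b| < e) ->
    frequently (fun n => P (iter n F x) /\ Q (iter n.+1 F x)) -> F a = b.
  move=> HP HQ f; apply: limit_step => // e e0.
  have [M HM] := HP e e0; have [N HN] := HQ e e0; have [n Nn [Pn Qn]] := f (M + N)%N.
  exists (iter n F x); first by apply: HM => //; lia.
  by rewrite -iterS; apply: HN => //; lia.
have freqLR (P Q : pred R) : (forall n, P (iter n F x) \/ Q (iter n F x)) ->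
    frequently (fun n => P (iter n F x)) -> frequently (fun n => Q (iter n F x)) ->
    frequently (fun n => P (iter n F x) /\ Q (iter n.+1 F x)).
  move=> PQ fP fQ N; have [n Nn Pn] := fP N; apply: contrapT => H.
  have PN k : P (iter (n + k) F x) /\ ~ Q (iter (n + k).+1 F x).
    elim: k => [|k [IHk1 IHk2]].
      by rewrite addn0; split=> // Qn; apply: H; exists n.
    rewrite addnS; case: (PQ (n + k).+1) => // h; split=> // Qn.
    by apply: H; exists (n + k).+1 => //; lia.
  have [m nm Qm] := fQ n.+1; have := (PN (m - n.+1)%N).2.
  by rewrite -addSn subnKC.
have FL : F l = r.
  apply: (trans (fun y => y < z) (fun y => z < y)) => //.
  exact: (freqLR (fun y => y < z) (fun y => z < y)).
have FR : F r = l.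
  apply: (trans (fun y => z < y) (fun y => y < z)) => //.
  apply: (freqLR (fun y => z < y) (fun y => y < z)) => // n.
  by case: (side n); [right|left].
(* Infinitely many repetitions on one side make [l] or [r] fixed; with finitely many on both sides
   the orbit would alternate. *)
have lr : l = r.
  have [LL|/frequentlyPn[N1 HN1]] :=
    pselect (frequently (fun n => iter n F x < z /\ iter n.+1 F x < z)).
    by rewrite -FL; apply/esym/(trans (fun y => y < z) (fun y => y < z)).
  have [RR|/frequentlyPn[N2 HN2]] :=
    pselect (frequently (fun n => z < iter n F x /\ z < iter n.+1 F x)).
    by rewrite -FR; apply/(trans (fun y => z < y) (fun y => z < y)).
  exfalso; apply: nalt; have [K NK Kz] := freqL (N1 + N2)%N.
  exists K; elim=> [|m IHm].
    rewrite muln0 addn0 Kz /=; case: (side K.+1) => // h.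
    by case: (HN1 K) => //; lia.
  move: IHm; rewrite mulnS addnCA.
  set q := (K + 2 * m)%N => /andP[h1 h2].
  have h3 : iter q.+2 F x < z.
    by case: (side q.+2) => // h; case: (HN2 q.+1) => //; lia.
  rewrite !add2n h3 /=; case: (side q.+3) => // h.
  by case: (HN1 q.+2) => //; lia.
left; exists l; first by rewrite FL.
move=> e e0; have [N1 HN1] := Hl e e0; have [N2 HN2] := Hr e e0.
exists (N1 + N2)%N => n nN; case: (side n) => h; first by apply: HN1 => //; lia.
by rewrite lr; apply: HN2 => //; lia.
Qed.

(** Along an alternating orbit, one descent of [F^2] on the left of [z] creates a trap; without any,
    the left points increase to a fixed point of [F^2]. *)
Lemma trapped_or_tends lo hi F x : tame lo hi F ->
  (exists2 e, F (F e) = e & tends (fun m => iter (2 * m) F x) e) \/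
  (exists z s t K, F z = z /\ trap F z s t /\ s <= iter K F x <= t).
Proof.
move=> tF; have [[lohi cF Fb _ _] _] := tF.
have [[e Fe xe]|[z Fz [K HK]]] := alternates_or_tends x tF.
  left; exists e; rewrite ?Fe // => d /xe[N HN]; exists N => n Nn.
  by apply: HN; lia.
pose y m := iter (K + 2 * m) F x.
have yS m : y m.+1 = F (F (y m)) by rewrite /y mulnS addnCA.
have [[m ym]|nd] := pselect (exists m, y m.+1 < y m).
  right; have [|s [t [svt T]]] := expanding_flip_trap tF Fz (HK m); first by rewrite -yS.
  by exists z, s, t, (K + 2 * m)%N; do 2 split=> //; lra.
left; have [||e ye] := @tends_nondecreasing _ y 0 z.
- by move=> n _; rewrite leNgt; apply/negP => h; apply: nd; exists n.
- by move=> n _; have /andP[/ltW] := HK n.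
have ge : F (F e) = e := tends_step_fixed (continuous_comp2 cF) ye yS.
(* [e] is the limit along the times of the parity of [K]; for odd [K] the even times tend to
   [F e]. *)
have [oK|oK] := boolP (odd K).
  exists (F e); first by rewrite ge.
  apply: (@tends_unshift _ _ _ K.+1./2).
  rewrite /= (_ : (fun n => _) = fun n => F (y n)); first exact: tends_continuous.
  by apply/funext => n; rewrite /y -iterS; congr iter; move: (odd_double_half K); rewrite oK; lia.
exists e => //; apply: (@tends_unshift _ _ _ K./2).
rewrite /= (_ : (fun n => _) = y) //; apply/funext => n.
by rewrite /y; congr iter; move: (odd_double_half K); rewrite (negbTE oK); lia.
Qed.

End Alternation.

(** * Proximal orbits *)

Section ProximalOrbits.
Variable R : realType.
Implicit Types (F : R -> R) (lo hi z v p x y w s t e l : R) (u : nat -> R).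

Definition cluster_point u p :=
  forall e, 0 < e -> frequently (fun n => `|u n - p| < e).

Lemma cluster_even_odd u l l' p : tends (fun m => u (2 * m)%N) l ->
  tends (fun m => u (2 * m).+1) l' -> cluster_point u p -> p = l \/ p = l'.
Proof.
move=> ul ul' up; apply: contrapT => /not_orP[/eqP pl /eqP pl'].
have e0 : 0 < Num.min `|p - l| `|p - l'| / 2.
  by rewrite divr_gt0 // lt_min !normr_gt0 !subr_eq0 pl.
have [N HN] := ul _ e0; have [N' HN'] := ul' _ e0.
have [n Nn Hn] := up _ e0 (2 * N + 2 * N').+1%N.
have [m1 m2] : Num.min `|p - l| `|p - l'| <= `|p - l| /\
    Num.min `|p - l| `|p - l'| <= `|p - l'| by rewrite !ge_min !lexx orbT.
have := odd_double_half n; rewrite -mul2n; case: odd => /= E.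
  have Nh : (N' <= n./2)%N by lia.
  have := HN' _ Nh; rewrite -add1n E => h.
  have := ler_distD (u n) p l'; rewrite (distrC p (u n)); lra.
have Nh : (N <= n./2)%N by lia.
have := HN _ Nh; rewrite -[X in u X]add0n E => h.
have := ler_distD (u n) p l; rewrite (distrC p (u n)); lra.
Qed.

Lemma tends_even_odd u l : tends (fun m => u (2 * m)%N) l ->
  tends (fun m => u (2 * m).+1) l -> tends u l.
Proof.
move=> ul ul' e e0; have [N HN] := ul e e0; have [N' HN'] := ul' e e0.
exists (2 * N + 2 * N').+1 => n Nn.
have := odd_double_half n; rewrite -mul2n; case: odd => /= E.
  by rewrite -E add1n; apply: HN'; lia.
by rewrite -E add0n; apply: HN; lia.
Qed.

Lemma tends_odd F x e : continuous F -> tends (fun m => iter (2 * m) F x) e ->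
  tends (fun m => iter (2 * m).+1 F x) (F e).
Proof. by move=> cF xe; apply: tends_continuous. Qed.

Lemma trap_sides F z s t x K n : trap F z s t -> s <= iter K F x <= t ->
  (K <= n)%N -> (s <= iter n F x <= t /\ z < iter n.+1 F x) \/
                (z < iter n F x /\ s <= iter n.+1 F x <= t).
Proof.
move=> T xK Kn; have := odd_double_half (n - K).
rewrite -mul2n; move: (n - K)./2 => k; case: odd => E.
  right; have -> : n = ((2 * k).+1 + K)%N by lia.
  rewrite -addSn !iterD; split; first by have [] := trap_iter k T xK.
  by have := trap_iter k.+1 T xK; rewrite mulnS => -[].
left; have -> : n = (2 * k + K)%N by lia.
by rewrite -addSn (iterD (2 * k)) (iterD (2 * k).+1); exact: (trap_iter k T xK).
Qed.

(** Close to a fixed cluster point [z], an orbit point and its image are both close to [z]. In a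
    trap one of them lies in [[s, t]], so [z] does too, but no point of [[s, t]] is fixed. *)
Lemma omega_fixed_unique lo hi F x z w : tame lo hi F -> F z = z ->
  cluster_point (fun n => iter n F x) z -> cluster_point (fun n => iter n F x) w ->
  w = z.
Proof.
move=> tF Fz xz xw; have [[_ cF _ _ _] _] := tF.
have [[e ge xe]|[z' [s [t [K [Fz' [T xK]]]]]]] := trapped_or_tends x tF.
  have xe' := tends_odd cF xe.
  have eE : e = z /\ F e = z.
    case: (cluster_even_odd xe xe' xz) => E; first by rewrite -E Fz.
    by move: Fz; rewrite E ge => h; rewrite -h.
  by case: (cluster_even_odd xe xe' xw) => ->; case: eE.
exfalso; have [stz HT] := T.
have near_st d : 0 < d -> exists2 y, s <= y <= t & `|y - z| < d.
  move=> d0; have [c c0 Hc] := continuous_eps z cF d0.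
  have [|n Kn] := xz (Num.min c d) _ K; first by rewrite lt_min c0.
  rewrite lt_min => /andP[/Hc h1 h2].
  have [[h _]|[_ h]] := trap_sides T xK Kn; first by exists (iter n F x).
  by exists (iter n.+1 F x) => //=; rewrite -[X in _ - X]Fz.
have zst : s <= z <= t.
  apply/andP; split; rewrite leNgt; apply/negP => h.
    have [|y yst] := near_st (s - z); first by lra.
    by rewrite ltr_norml; lra.
  have [|y yst] := near_st (z - t); first by lra.
  by rewrite ltr_norml; lra.
by have [] := HT z zst; rewrite Fz; lra.
Qed.

(** The orbits are out of phase: at each time one lies in [[s, t]] and the other beyond [z], at
    distance more than [z - t]. *)
Lemma trap_not_proximal F z s t v v' : trap F z s t -> s <= v <= t -> z < v' ->
  s <= F v' <= t -> ~ cluster_point (fun n => `|iter n F v - iter n F v'|) 0.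
Proof.
move=> T vst zv' Fv' H; have [stz _] := T.
have [|n _] := H (z - t) _ 0%N; first by lra.
rewrite subr0 normr_id; have := odd_double_half n.
rewrite -mul2n; move: n./2 => k; case: odd => <-.
  have [_ h1] := trap_iter k T vst; have [h2 _] := trap_iter k T Fv'.
  by rewrite add1n [iter _ F v']iterSr ltr_norml; lra.
have [h1 _] := trap_iter k T vst; rewrite add0n.
suff h2 : z < iter (2 * k) F v' by rewrite ltr_norml; lra.
case: k {h1} => [//|k]; have [_] := trap_iter k T Fv'.
by rewrite mulnS !iterS -iterSr.
Qed.

Lemma proximal_dense_tends lo hi F x : tame lo hi F ->
  (forall y y' d, lo <= y <= hi -> lo <= y' <= hi -> 0 < d -> exists v v',
    [/\ `|v - y| < d, `|v' - y'| < d &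
        cluster_point (fun n => `|iter n F v - iter n F v'|) 0]) ->
  exists2 e, F (F e) = e & tends (fun m => iter (2 * m) F x) e.
Proof.
move=> tF H; have [[_ cF Fb _ _] _] := tF.
have [//|[z [s [t [K [Fz [T xK]]]]]]] := trapped_or_tends x tF.
exfalso; have [stz HT] := T.
(* Two further steps lead strictly inside the trap, so all pairs near [(y, F y)] are out of
   phase. *)
pose y := iter K.+2 F x.
have yst : s < y < t by have [] := HT _ xK.
have [zFy gyst] : z < F y /\ s < F (F y) < t by apply: HT; lra.
have e0 : 0 < Num.min (F (F y) - s) (t - F (F y)) by rewrite lt_min; lra.
have [d0 d1 Hd] := continuous_eps (F y) cF e0.
pose d := Num.min (Num.min (y - s) (t - y)) (Num.min d0 (F y - z)).
have [|v [v' [vy v'y]]] := H y (F y) d (Fb _) (Fb _).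
  by rewrite !lt_min; lra.
move: vy v'y; rewrite !lt_min !ltr_norml => /andP[/andP[v1 v2] _].
move=> /andP[_ /andP[v3 v4]].
have := Hd v'; rewrite !lt_min !ltr_norml => v5.
by apply: (trap_not_proximal T); lra.
Qed.

End ProximalOrbits.

Section ProximalPairs.
Variable R : realType.
Implicit Types (F : R -> R) (lo hi z x y e : R) (u : nat -> R).

Lemma tends_dist u u' e e' : tends u e -> tends u' e' ->
  tends (fun n => `|u n - u' n|) `|e - e'|.
Proof.
move=> ue ue' d d0; have d2 : 0 < d / 2 by lra.
have [N HN] := ue _ d2; have [N' HN'] := ue' _ d2.
exists (N + N')%N => n Nn.
have /HN h1 : (N <= n)%N by lia.
have /HN' h2 : (N' <= n)%N by lia.
apply: (le_lt_trans (ler_dist_dist _ _)).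
have -> : u n - u' n - (e - e') = (u n - e) - (u' n - e') by ring.
apply: (le_lt_trans (ler_normB _ _)); lra.
Qed.

(** The distances tend to [|e - e'|] along even times and to [|F e - F e'|] along odd times; if one
    limit vanishes, so does the other. *)
Lemma proximal_asymptotic F x y e e' : continuous F -> F (F e) = e ->
  F (F e') = e' -> tends (fun m => iter (2 * m) F x) e ->
  tends (fun m => iter (2 * m) F y) e' ->
  cluster_point (fun n => `|iter n F x - iter n F y|) 0 ->
  tends (fun n => `|iter n F x - iter n F y|) 0.
Proof.
move=> cF ge ge' xe ye' xy.
have even := tends_dist xe ye'.
have odd := tends_dist (tends_odd cF xe) (tends_odd cF ye').
have ee' : e = e'.
  have [/esym/eqP|/esym/eqP] := cluster_even_odd even odd xy.
    by rewrite normr_eq0 subr_eq0 => /eqP.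
  by rewrite normr_eq0 subr_eq0 => /eqP E; rewrite -ge E ge'.
by apply: tends_even_odd; move: even odd; rewrite ee' !subrr normr0.
Qed.

Lemma consecutive_proximal_asymptotic lo hi F x : tame lo hi F ->
  cluster_point (fun n => `|iter n F x - iter n F (F x)|) 0 ->
  tends (fun n => `|iter n F x - iter n F (F x)|) 0.
Proof.
move=> tF prox; have [[_ cF _ _ _] _] := tF.
have [[e ge xe]|[z [s [t [K [Fz [T xK]]]]]]] := trapped_or_tends x tF.
  apply: (@proximal_asymptotic F x (F x) e (F e)) => //; first by rewrite ge.
  have := tends_odd cF xe; rewrite (_ : (fun _ => _) = fun m => iter (2 * m) F (F x)) //.
  by apply/funext => m; rewrite iterSr.
have [stz _] := T; exfalso.
have [|n Kn] := prox (z - t) _ K; first by lra.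
rewrite subr0 normr_id -iterSr ltr_norml.
by have [] := trap_sides T xK Kn; lra.
Qed.

End ProximalPairs.

(** * Chain recurrence *)

Definition chain_rec (R : realType) (lo hi : R) (F : R -> R) (x : R) : Prop :=
  forall eps, 0 < eps -> exists (n : nat) (s : nat -> R),
    [/\ (1 <= n)%N, forall i, (i <= n)%N -> lo <= s i <= hi, s 0%N = x, s n = x &
        forall i, (i < n)%N -> `|F (s i) - s i.+1| < eps].

Section ChainRecurrence.
Variable R : realType.
Implicit Types (F : R -> R) (lo hi z v x y c s t e : R).

Lemma chain_rec_mirror lo hi F x :
  chain_rec lo hi F x -> chain_rec (- hi) (- lo) (mirror F) (- x).
Proof.
move=> H e /H[n [s [n1 sI s0 sn Hs]]]; exists n, (fun i => - s i).
split=> // [i /sI||| i /Hs]; [lra|by rewrite s0|by rewrite sn|].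
by rewrite /mirror !opprK -normrN opprD !opprK.
Qed.

Lemma not_chain_rec lo hi F (E : R -> Prop) x e : 0 < e -> ~ E x ->
  (forall y y', lo <= y' <= hi -> E y \/ y = x -> `|F y - y'| < e -> E y') ->
  ~ chain_rec lo hi F x.
Proof.
move=> e0 nEx H /(_ e e0)[n [s [n1 sI s0 sn Hs]]].
have Es i : (i < n)%N -> E (s i.+1).
  elim: i => [|i IHi] ltin.
    by apply: (H (s 0%N)); [exact: sI|right|exact: Hs].
  by apply: (H (s i.+1)); [exact: sI|left; exact/IHi/ltnW|exact: Hs].
by apply: nEx; rewrite -sn -(prednK n1); apply: Es; rewrite prednK.
Qed.

(** Density tested on the open intervals of the line that meet the interior of [[lo, hi]]. *)
Definition dense_chain_rec lo hi F :=
  forall a b, a < b -> a < hi -> lo < b -> exists2 y, a < y < b & chain_rec lo hi F y.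

(** A point near [F ([s, t])] either belongs to it or is close to an extreme value of [F] on
    [[s, t]]; continuity of [h] at these two values gives a uniform [e]. *)
Lemma image_neighbourhood F (h : R -> R) s t (m M d : R) : continuous F -> continuous h -> s <= t ->
  (forall y, s <= y <= t -> m <= h (F y) <= M) -> 0 < d ->
  exists2 e, 0 < e & forall y y', s <= y <= t -> `|F y - y'| < e ->
    m - d < h y' < M + d.
Proof.
move=> cF ch st H d0.
have [a aI Ha] := itv_max cF st; have [b bI Hb] := itv_min cF st.
have ha := H _ aI; have hb := H _ bI.
have [e1 e10 He1] := continuous_eps (F a) ch d0.
have [e2 e20 He2] := continuous_eps (F b) ch d0.
exists (Num.min e1 e2); first by rewrite lt_min e10.
move=> y y' yst; have hy := Ha _ yst; have yh := Hb _ yst.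
rewrite lt_min !ltr_norml => yy'.
have [y'a|ay'] := leP y' (F a); last first.
  have /He1 : `|y' - F a| < e1 by rewrite ltr_norml; lra.
  by rewrite ltr_norml; lra.
have [by'|y'b] := leP (F b) y'; last first.
  have /He2 : `|y' - F b| < e2 by rewrite ltr_norml; lra.
  by rewrite ltr_norml; lra.
suff [w wst <-] : exists2 w, s <= w <= t & F w = y' by have := H w wst; lra.
have [ba|ab] := leP b a.
  have [|w wI Fw] := ivt_up (y := y') cF ba; first by rewrite by'.
  by exists w => //; lra.
have [|w wI Fw] := ivt_down (y := y') cF (ltW ab); first by rewrite by'.
by exists w => //; lra.
Qed.

(* For small [eps], an [eps]-chain from a point of [[s, t]] above [F^2 ([s, t])]
   alternates between neighbourhoods of [F ([s, t])] and of [F^2 ([s, t])]. *)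
Lemma trap_not_dense lo hi F z s t : interval_map lo hi F -> trap F z s t ->
  ~ dense_chain_rec lo hi F.
Proof.
move=> [lohi cF Fb _ _] [stz HT] D.
have st : s <= t by lra.
have cg := continuous_comp2 cF.
have [a aI Ha] := itv_max cg st; have [b bI Hb] := itv_min cg st.
have [c cI Hc] := itv_min cF st.
have [zc _] := HT _ cI; have [_ /andP[_ at_]] := HT _ aI; have [_ /andP[sb _]] := HT _ bI.
have hic := Fb c; have loa := Fb (F a).
move: (F (F a)) (F (F b)) at_ sb loa Ha Hb => M m Mt sm loM HM Hm.
have mM y : s <= y <= t -> m <= F (F y) <= M by move=> yst; rewrite Hm // HM.
(* [[m, M]] is the range of [F^2] on [[s, t]]; enlarged by [2 * d] it still lies inside [(s, t)]. *)
have [d [d0 dm dM]] : exists d, [/\ 0 < d, d < (m - s) / 2 & d < (t - M) / 2].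
  by apply: between_min; lra.
have [e1 e10 He1] := image_neighbourhood cF cF st mM d0.
have [e [e0 ee1 ed ez]] : exists e, [/\ 0 < e, e <= e1, e <= d & e <= F c - z].
  exists (Num.min e1 (Num.min d (F c - z))).
  by rewrite !lt_min e10 d0 subr_gt0 zc !ge_min !lexx !orbT.
have [|||x xI] := D (M + 2 * d) t; try lra.
pose E y := m - 2 * d < y < M + 2 * d \/ z < y /\ m - d < F y < M + d.
have sM : s < M by have := mM a aI; lra.
clear loM hic D Fb.
apply: (@not_chain_rec lo hi F E x e e0); first by move=> [|[]]; lra.
have step y y' : s <= y <= t -> `|F y - y'| < e -> E y'.
  move=> yst yy'; right; split; last exact: He1 yst (lt_le_trans yy' ee1).
  by have := Hc _ yst; move: yy'; rewrite ltr_norml; lra.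
move=> y y' _ [[yE|[zy yE]]|->] yy'.
- by apply: (step y) => //; lra.
- by left; move: yy'; rewrite ltr_norml; lra.
- by apply: (step x) => //; lra.
Qed.

Lemma dense_chain_rec_flip lo hi F z v : tame lo hi F -> dense_chain_rec lo hi F ->
  F z = z -> v < z < F v -> v <= F (F v).
Proof.
move=> tF D Fz vz; rewrite leNgt; apply/negP => gv.
have [s [t [_ T]]] := expanding_flip_trap tF Fz vz gv.
by case: tF => iF _; exact: (trap_not_dense iF T D).
Qed.

(** Chains with small errors from a point of [(c, q)] enter [[q, t]] at once and never leave it. *)
Lemma absorbing_not_dense lo hi F c t d : interval_map lo hi F -> lo <= c ->
  c < d <= t -> (forall y, c <= y <= t -> d <= F y) ->
  t = hi \/ (forall y, c <= y <= t -> F y < t) -> t <= hi ->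
  ~ dense_chain_rec lo hi F.
Proof.
move=> [lohi cF Fb _ _] loc cdt Hd Ht thi D.
pose q := (c + d) / 2.
have [q1 q2] : c < q /\ q < d by rewrite /q; lra.
have [||x xI] := D c q q1; try lra.
(* If [t = hi], chains cannot pass [t] because they stay in the interval; otherwise the maximum of
   [F] on [[c, t]] leaves a margin. *)
have [e [e0 eq He]] : exists e, [/\ 0 < e, e <= d - q &
    forall y y', c <= y <= t -> y' <= hi -> `|F y - y'| < e -> y' <= t].
  case: Ht => [->|Ht].
    by exists (d - q); split=> //; lra.
  have ct : c <= t by lra.
  have [cX cXI HX] := itv_max cF ct; have hX := Ht _ cXI.
  exists (Num.min (d - q) (t - F cX)); split.
  - by rewrite lt_min; lra.
  - by rewrite ge_min lexx.
  move=> y y' /HX h1 _; rewrite lt_min !ltr_norml; lra.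
apply: (@not_chain_rec lo hi F (fun y => q <= y <= t) x e e0); first by lra.
move=> y y' y'I yE yy'.
have yct : c <= y <= t by case: yE => [|->]; lra.
have := He y y' yct _ yy'; have := Hd y yct; move: yy'; rewrite ltr_norml.
move=> h1 h2 h3; have : y' <= t by apply: h3; lra.
lra.
Qed.

(* Let [z] be the first fixed point above [c].  Both [F] and [F^2] exceed some
   [d > c] on [[c, z]]; chains from [c] can come back to [c] only through the
   first point [t > z] where [F t = d], and none reaches [t]. *)
Lemma dense_chain_rec_period2_up lo hi F c : tame lo hi F ->
  dense_chain_rec lo hi F -> lo <= c <= hi -> c < F c -> F (F c) = c.
Proof.
move=> tF D cI cFc; have [iF _] := tF; have [lohi cF Fb _ _] := iF.
apply: contrapT => gc.
have Fhi := Fb hi.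
have [|||z [czh Fz zmin]] := first_fixed (a := c) (b := hi) cF; try lra.
have flip := dense_chain_rec_flip tF D Fz.
have g_up v : c <= v <= z -> c < F (F v).
  move=> vz; have [ze|ze] := eqVneq v z; first by rewrite ze !Fz; lra.
  have vlt : v < z by rewrite lt_neqAle ze; lra.
  have vF : v < F v by apply: zmin; lra.
  have [Fvz|zFv|Fvz] := ltgtP (F v) z; last by rewrite Fvz Fz; lra.
    by have : F v < F (F v) by [apply: zmin; lra]; lra.
  have vg : v <= F (F v) by apply: flip; lra.
  (* At [v = c] strictness comes from [F (F c) <> c]. *)
  have [vc|vc] := eqVneq v c; last by have : c < v by [rewrite lt_neqAle eq_sym vc; lra]; lra.
  by rewrite lt_neqAle -{2}vc vg andbT; subst v; apply/eqP => /esym.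
have f_up v : c <= v <= z -> c < F v.
  move=> vz; have [ze|ze] := eqVneq v z; first by rewrite ze Fz; lra.
  have vlt : v < z by rewrite lt_neqAle ze; lra.
  by have : v < F v by [apply: zmin; lra]; lra.
have cz : c <= z by lra.
have [c1 c1I H1] := itv_min cF cz; have h1 := f_up _ c1I.
have [c2 c2I H2] := itv_min (continuous_comp2 cF) cz; have h2 := g_up _ c2I.
have [d [cd d1 d2]] := between_min h1 h2.
have fd y : c <= y <= z -> d < F y by move=> /H1; exact: lt_le_trans.
have gd y : c <= y <= z -> d < F (F y) by move=> /H2; exact: lt_le_trans.
have dz : d < z by rewrite -Fz; apply: fd; rewrite cz lexx.
have zhi : z <= hi by case/andP: czh.
have [loc chi] := andP cI.
clear flip f_up g_up gc zmin czh cI h1 c1I H1 h2 c2I H2 d1 d2 cFc Fhi.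
have [[t1 t1I Ft1]|nt] := pselect (exists2 t, z <= t <= hi & F t <= d); last first.
  apply: (@absorbing_not_dense lo hi F c hi d) => //; [lra| |by left].
  move=> y yI; have [yz|zy] := leP y z; first by apply/ltW/fd; lra.
  by rewrite leNgt; apply/negP => h; apply: nt; exists y; lra.
have [|||t [tI Ft tmin]] := first_down (a := z) (b := t1) (y := d) cF; try lra.
apply: (@absorbing_not_dense lo hi F c t d) => //; [lra| | |lra].
  move=> y yI; have [yz|zy] := leP y z; first by apply/ltW/fd; lra.
  have [yt|ty] := ltP y t; first by apply/ltW/tmin; lra.
  by have -> : y = t by [lra]; rewrite Ft.
(* A value at least [t] taken on [[c, z]] would give a [v] there with [F (F v) = F t = d]; taken on
   [(z, t)] it would give a horseshoe of [F] on [[z, t]]. *)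
right=> y yI; rewrite ltNge; apply/negP => tFy.
have [yz|zy] := leP y z.
  have [|v vI Fv] := ivt_down (a := y) (b := z) (y := t) cF yz.
    by lra.
  have : d < F (F v) by apply: gd; lra.
  by rewrite Fv Ft ltxx.
have yt : y <> t by move=> e; move: tFy; rewrite e Ft; lra.
have := @no_horseshoe_up _ lo hi F z y t tF; rewrite Fz Ft.
by move=> h; have : F y < t by [apply: h; lra]; lra.
Qed.

Lemma dense_chain_rec_mirror lo hi F :
  dense_chain_rec lo hi F -> dense_chain_rec (- hi) (- lo) (mirror F).
Proof.
move=> D a b ab aM bm; have [|||y yI yc] := D (- b) (- a); try lra.
by exists (- y); [lra|exact: chain_rec_mirror].
Qed.

Lemma dense_chain_rec_period2 lo hi F c : tame lo hi F ->
  dense_chain_rec lo hi F -> lo <= c <= hi -> F (F c) = c.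
Proof.
move=> tF D cI; have [Fc|cF|Fc] := ltgtP (F c) c; last by rewrite !Fc.
  apply: oppr_inj.
  have := dense_chain_rec_period2_up (c := - c) (tame_mirror tF)
    (dense_chain_rec_mirror D).
  by rewrite /mirror !opprK ltrN2; apply=> //; lra.
exact: dense_chain_rec_period2_up tF D cI cF.
Qed.

End ChainRecurrence.

(** * From the interval to the whole line *)

Section Transfer.
Variable R : realType.
Implicit Types (f F : R -> R) (u v lo hi x y e : R) (a : nat -> R).

Lemma tends_cvg a l : tends a l -> a n @[n --> \oo] --> l.
Proof.
move=> al; apply/cvgrPdist_lt => e e0; have [N HN] := al e e0.
by exists N => // n /= Nn; rewrite distrC; exact: HN.
Qed.

Lemma tends_limn_esup a : tends a 0 -> limn_esup (fun n => (a n)%:E) = 0%E.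
Proof.
move=> /tends_cvg a0; have -> // := (cvg_limn_einf_sup (_ : _ --> 0%:E)).2.
by apply: cvg_EFin; [exact: nearW | exact: a0].
Qed.

Lemma limn_einf_cluster a : (forall n, 0 <= a n) ->
  limn_einf (fun n => (a n)%:E) = 0%E -> cluster_point a 0.
Proof.
move=> a0 + e e0; rewrite limn_einf_lim => lim0; apply: contrapT.
move=> /frequentlyPn[N HN].
suff : (e%:E <= limn (einfs (fun n => (a n)%:E)))%E.
  by rewrite lim0 lee_fin leNgt e0.
apply: lime_ge; first exact: is_cvg_einfs.
exists N => // m /= Nm; apply: le_ereal_inf_tmp => _ [k /= mk <-].
rewrite lee_fin leNgt; apply/negP => ake; apply: (HN k).
  exact: leq_trans mk.
by rewrite subr0 ger0_norm.
Qed.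

Lemma closureR (A : set R) x e : closure A x -> 0 < e ->
  exists2 y, A y & `|y - x| < e.
Proof.
move=> /(_ _ (nbhsx_ballx x e _)) H e0; have [y [Ay]] := H e0.
by rewrite /ball/= distrC => ye; exists y.
Qed.

Lemma closureR2 (A : set (R * R)) x y e : closure A (x, y) -> 0 < e ->
  exists p, [/\ A p, `|p.1 - x| < e & `|p.2 - y| < e].
Proof.
move=> /(_ _ (nbhsx_ballx (x, y) e _)) H e0; have [p [Ap []]] := H e0.
by rewrite /ball/= (distrC x) (distrC y) => h1 h2; exists p.
Qed.

Lemma tends_asymptotic F x e : continuous F -> F (F e) = e ->
  tends (fun m => iter (2 * m) F x) e ->
  tends (fun n => `|iter n F x - iter n F e|) 0.
Proof.
move=> cF ge xe.
have ee m : iter (2 * m) F e = e by elim: m => // m IHm; rewrite mulnS /= IHm.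
have cst c : tends (fun _ => c) c.
  by move=> d d0; exists 0%N => n _; rewrite subrr normr0.
have even : tends (fun m => iter (2 * m) F e) e.
  by rewrite (_ : (fun _ => _) = fun _ => e) //; apply/funext.
apply: tends_even_odd.
  by have := tends_dist xe even; rewrite subrr normr0.
by have := tends_dist (tends_odd cF xe) (tends_odd cF even); rewrite subrr normr0.
Qed.

(** The retraction of the line onto [[u, v]]; composing [f] with it gives a continuous map of the
    line that agrees with [f] on [[u, v]]. *)
Definition clamp u v x := Num.max u (Num.min x v).

Lemma clamp_in u v x : u < v -> u <= clamp u v x <= v.
Proof.
rewrite /clamp => uv.
by case: (leP x v) => ?; [case: (leP u x)|case: (leP u v)] => ?; lra.
Qed.

Lemma clamp_id u v x : u <= x <= v -> clamp u v x = x.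
Proof. by move=> /andP[ux xv]; rewrite /clamp (min_idPl xv) (max_idPr ux). Qed.

Lemma clamp_lipschitz u v x y : u < v -> `|clamp u v x - clamp u v y| <= `|x - y|.
Proof.
move=> uv; wlog yx : x y / y <= x => [W|].
  by have [/W//|/ltW/W] := leP y x; rewrite distrC (distrC y).
rewrite (ger0_norm (_ : 0 <= x - y)) ?subr_ge0 // ler_norml /clamp.
by clear -yx uv; case: (leP x v) => ?; case: (leP y v) => ?;
  case: (leP u x) => ?; case: (leP u y) => ?; case: (leP u v) => ?; lra.
Qed.

Lemma interval_map_clamp u v f : u < v -> {within `[u, v], continuous f} ->
  f @` `[u, v] `<=` `[u, v] -> interval_map u v (f \o clamp u v).
Proof.
move=> uv /subspace_continuousP cf fI.
have cI x : [set` `[u, v]] (clamp u v x) by rewrite /= in_itv /= clamp_in.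
split=> //.
- move=> x; apply/cvgrPdist_lt => e e0.
  have /cvgrPdist_lt/(_ e e0) := cf _ (cI x).
  rewrite near_withinE => -[d d0 Hd]; exists d => // y /= xy.
  apply: (Hd (clamp u v y)); last exact: cI.
  exact: (le_lt_trans (clamp_lipschitz x y uv) xy).
- move=> x; have : [set` `[u, v]] (f (clamp u v x)) by apply: fI; exists (clamp u v x).
  by rewrite /= in_itv.
- move=> x xu /=; congr f; rewrite /clamp (min_idPl (ltW uv)) maxxx.
  by rewrite (min_idPl _) ?(max_idPl _) //; lra.
- move=> x vx /=; congr f; rewrite /clamp minxx.
  by rewrite (min_idPr _).
Qed.

Lemma turb_turbulent (h F : R -> R) k l (I : set R) : I `<=` [set x | h x = F x] ->
  `[k, l] `<=` I -> turb F k l -> turbulent h `[k, l].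
Proof.
move=> hF klI [a [b [c [d [ab bc cd H]]]]].
have kab : `[a, b] `<=` `[k, l].
  by move=> x; rewrite /= !in_itv /=; lra.
have kcd : `[c, d] `<=` `[k, l].
  by move=> x; rewrite /= !in_itv /=; lra.
exists [set` `[a, b]], [set` `[c, d]]; split.
- by split => //; exists a, b; split => //; lra.
- by split => //; exists c, d; split => //; lra.
- by move=> x y [/= + +] [/= + +]; rewrite !in_itv /=; lra.
- move=> y /=; rewrite !in_itv /= => yab.
  have [[x xab hx] [x' xcd hx']] := H y yab; split.
    exists x; first by rewrite /= in_itv.
    by rewrite -hx; apply/hF/klI/kab; rewrite /= in_itv.
  exists x'; first by rewrite /= in_itv.
  by rewrite -hx'; apply/hF/klI/kcd; rewrite /= in_itv.
Qed.

Lemma iter_eq_on (I : set R) f F n x : (forall y, I y -> F y = f y) ->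
  f @` I `<=` I -> I x -> I (iter n f x) /\ iter n F x = iter n f x.
Proof.
move=> Ff fI Ix; elim: n => [//|n [IHn1 IHn2]]; rewrite !iterS IHn2 Ff //.
by split=> //; apply: fI; exists (iter n f x).
Qed.

Lemma turb_lt F k l : turb F k l -> k < l.
Proof. by move=> [a [b [c [d [? ? ? _]]]]]; lra. Qed.

Lemma rich_dynamics_transfer u v f F :
  (forall x, [set` `[u, v]] x -> F x = f x) -> f @` `[u, v] `<=` `[u, v] ->
  rich_dynamics u v F ->
  (forall n : nat, (0 < n)%N -> ~~ odd n ->
    exists x : R, periodic_point `[u, v] f n x) /\
  doubly_turbulent (iter 2 f) `[u, v].
Proof.
move=> Ff fI [H [k1 [l1 [k2 [l2 [uk lk lv T1 T2]]]]]]; split.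
  move=> n n0 on; have nE : n = (2 * n./2)%N by have := odd_double_half n; lia.
  have [|x [xI xn xm]] := H n./2; first by lia.
  have Ix : [set` `[u, v]] x by rewrite /= in_itv.
  have eq m := (iter_eq_on m Ff fI Ix).2.
  exists x; split=> //; first by rewrite -eq nE.
  by move=> m mn; rewrite -eq; apply: xm; rewrite -nE.
have kl1 := turb_lt T1; have kl2 := turb_lt T2.
have s1 : `[k1, l1] `<=` `[u, v] by move=> x; rewrite /= !in_itv /=; lra.
have s2 : `[k2, l2] `<=` `[u, v] by move=> x; rewrite /= !in_itv /=; lra.
have eq2 : `[u, v] `<=` [set x | iter 2 f x = iter 2 F x].
  by move=> x Ix; have [_ E] := iter_eq_on 2 Ff fI Ix; exact: esym E.
exists [set` `[k1, l1]], [set` `[k2, l2]]; split.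
- by split => //; exists k1, l1.
- by split => //; exists k2, l2.
- by move=> x y [/= + +] [/= + +]; rewrite !in_itv /=; lra.
- exact: turb_turbulent eq2 s1 T1.
- exact: turb_turbulent eq2 s2 T2.
Qed.

End Transfer.

(** * The criteria, each refuted for a tame map *)

Unset Implicit Arguments.
Set Strict Implicit.

Theorem corollary2 (R : realType) (I : set R) (f : R -> R)
    (I_itv : compact_interval I)
    (f_cont : {within I, continuous f})
    (f_self : f @` I `<=` I) :
  (* (1) *)
  ((exists (c : R) (n : nat),
      [/\ I c, odd n, (1 < n)%N &
          (iter n f c <= c /\ c < f c) \/ (f c < c /\ c <= iter n f c)])
   (* (1), particular case *)
   \/ (exists (n : nat) (x : R),
      [/\ odd n, (1 < n)%N & periodic_point I f n x])
   (* (2) *)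
   \/ (dense_in I [set x | chain_recurrent I f x]
       /\ exists a : R, I a /\ iter 2 f a <> a)
   (* (3) *)
   \/ (exists b z w : R,
      [/\ I b, omega_limit f b z, f z = z, omega_limit f b w & w <> z])
   (* (4) *)
   \/ ((exists x : R, I x /\ ~ asymptotically_periodic_1_2 I f x)
       /\ dense_in (I `*` I) (proximal_pairs I f))
   (* (4), particular case *)
   \/ densely_chaotic I f
   (* (5) *)
   \/ (exists c : R,
      [/\ I c, (0 < limsup_dist f c (f c))%E & liminf_dist f c (f c) = 0%E]))
  ->
  (forall n : nat, (0 < n)%N -> ~~ odd n -> exists x : R, periodic_point I f n x)
  /\ doubly_turbulent (iter 2 f) I.
Proof.
case: I_itv f_cont f_self => u [v [uv ->]] {I} f_cont f_self.
set I := [set` `[u, v]]; pose F := f \o clamp u v.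
have iF : interval_map u v F by exact: interval_map_clamp.
have inI x : I x <-> u <= x <= v by rewrite /I /= in_itv.
have Ff x : I x -> F x = f x by move=> /inI xI; rewrite /F /= clamp_id.
have If x : I x -> I (f x) by move=> Ix; apply: f_self; exists x.
have iterF n x : I x -> iter n F x = iter n f x.
  by move=> Ix; have [] := iter_eq_on n Ff f_self Ix.
have iterI n x : I x -> I (iter n f x).
  by move=> Ix; have [] := iter_eq_on n Ff f_self Ix.
(* Arguing by contradiction makes [F] tame, so each hypothesis only has to be refuted. *)
move=> H; apply: (rich_dynamics_transfer Ff f_self); apply: contrapT => nC.
have tF : tame u v F by [].
have [_ cF Fb _ _] := iF.
have case1 c n : I c -> odd n ->
    ~ ((iter n f c <= c /\ c < f c) \/ (f c < c /\ c <= iter n f c)).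
  move=> Ic on; rewrite -(iterF n c Ic) -(Ff c Ic) => -[[h1 h2]|[h1 h2]].
    exact: (odd_return_up tF on h2 h1).
  exact: (odd_return_down tF on h1 h2).
have prox x y : I x -> I y -> liminf_dist f x y = 0%E ->
    cluster_point (fun n => `|iter n F x - iter n F y|) 0.
  move=> Ix Iy h; apply: limn_einf_cluster => //; rewrite -[RHS]h.
  by congr limn_einf; apply/funext => n; rewrite !iterF.
have nlimsup x y : I x -> I y -> tends (fun n => `|iter n F x - iter n F y|) 0 ->
    ~ (0 < limsup_dist f x y)%E.
  move=> Ix Iy /tends_limn_esup h; rewrite /limsup_dist.
  rewrite (_ : (fun n => _) = fun n => `|iter n F x - iter n F y|%:E) ?h ?ltxx //.
  by apply/funext => n; rewrite !iterF.
have case4 : I `*` I `<=` closure (proximal_pairs I f) -> forall x,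
    exists2 e, F (F e) = e & tends (fun m => iter (2 * m) F x) e.
  move=> D x; apply: (proximal_dense_tends x tF) => y y' d yI y'I d0.
  have Dyy : (I `*` I) (y, y') by split; apply/inI.
  have [[w w'] [[/= Iw Iw' h] wy w'y]] := closureR2 (D _ Dyy) d0.
  by exists w, w'; split=> //; exact: prox.
case: H => [[c [n [Ic on _ h]]]|[[n [x [on n1 [Ix _ xn xm]]]]|[[[_ D] [a [Ia ga]]]|
  [[b [z [w [Ib bz fz bw wz]]]]|[[[x [Ix nx]] [_ D]]|[[_ D]|[c [Ic cs ci]]]]]]]].
- exact: case1 Ic on h.
- have fx : f x <> x by exact: (xm 1%N).
  apply: (case1 x n Ix on); rewrite xn.
  by case: (ltgtP x (f x)) => [? | ? | /esym//]; [left|right].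
- apply: ga; rewrite -(iterF 2 a Ia); apply: (dense_chain_rec_period2 tF).
    move=> a' b' ab au bv.
    have [y [y1 y2 Iy]] : exists y, [/\ a' < y, y < b' & I y].
      clear -uv ab au bv inI; have [ua|ua] := ltP u a'.
        have [y [? ? ?]] := between_min ab au.
        by exists y; split=> //; apply/inI; lra.
      have [y [? ? ?]] := between_min bv uv.
      by exists y; split; [lra|lra|apply/inI; lra].
    have e0 : 0 < Num.min (y - a') (b' - y) by rewrite lt_min; lra.
    have [t ct] := closureR (D _ Iy) e0.
    rewrite lt_min !ltr_norml => ty; exists t; first by lra.
    move=> e /ct[n [s [n1 sI s0 sn Hs]]]; exists n, s; split=> // i ltin.
    by rewrite Ff; [exact: Hs|exact/sI/ltnW].
  exact/inI.
- have cl p : omega_limit f b p -> cluster_point (fun n => iter n F b) p.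
    move=> op e e0 N; have [_ [n /= Nn <-] ne] := closureR (op N Logic.I) e0.
    by exists n => //; rewrite iterF.
  have near_I d : 0 < d -> exists2 y, u <= y <= v & `|y - z| < d.
    move=> d0; have [n _ hn] := cl z bz d d0 0%N; exists (iter n F b) => //.
    by rewrite iterF //; apply/inI/iterI.
  have Iz : I z.
    apply/inI/andP; split; rewrite leNgt; apply/negP => h.
      have [|y yI] := near_I (u - z); first by lra.
      by rewrite ltr_norml; lra.
    have [|y yI] := near_I (z - v); first by lra.
    by rewrite ltr_norml; lra.
  apply: wz; apply: (omega_fixed_unique tF _ (cl z bz) (cl w bw)).
  by rewrite Ff.
- have [e ge xe] := case4 D x; apply: nx.
  (* [e] lies in the interval because it is the value [F (F e)]. *)
  have Ie : I e by apply/inI; rewrite -ge.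
  exists e; split=> //; first by rewrite -(iterF 2 e Ie).
  have := tends_cvg (tends_asymptotic cF ge xe).
  by rewrite (_ : (fun n => _) = fun n => `|iter n f x - iter n f e|) //;
    apply/funext => n; rewrite !iterF.
(* Li-Yorke pairs are proximal, so every orbit converges along even times; one Li-Yorke pair, found
   near [(u, u)], would then be asymptotic. *)
- have Dp : I `*` I `<=` closure (proximal_pairs I f).
    by apply: (subset_trans D); apply: closureS => p [].
  have Iuu : (I `*` I) (u, u) by split; apply/inI => /=; lra.
  have [[x y] [[/= Ix Iy hs hi] _ _]] := closureR2 (D _ Iuu) (@ltr01 R).
  have [[e ge xe] [e' ge' ye']] := (case4 Dp x, case4 Dp y).
  exact: (nlimsup x y Ix Iy (proximal_asymptotic cF ge ge' xe ye' (prox x y Ix Iy hi))).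
- apply: (nlimsup c (f c) Ic (If c Ic) _ cs); rewrite -(Ff c Ic).
  apply: (consecutive_proximal_asymptotic tF); rewrite (Ff c Ic).
  exact: (prox c (f c) Ic (If c Ic) ci).
Qed.
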